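(* Let $P$ be a finite poset and $K$ a field. Let $S=K[U_J]$ be the polynomial ring with one variable $U_J$ for each connected order ideal $J$ of $P$, and let $I_P\subseteq S$ be the kernel of the $K$-algebra homomorphism $S\to K[t_x: x\in P]$ sending $U_J\mapsto\prod_{x\in J}t_x$ (equivalently, the ideal generated by all differences $m_1-m_2$ of monomials of $S$ having the same degree $\deg$, where $\deg$ is the multiplicative map sending $U_J$ to $\chi_J=\sum_{x\in J}e_x\in\mathbb{Z}_{\geq0}^{P}$). Then $P$ is a forest with duplications if and only if $S/I_P$ (the ring of $P$-partitions) is a complete intersection.
   Context: A (lower) order ideal of $P$ is a subset $J$ with $y\in J$, $x\preceq y$ implying $x\in J$; it is a connected order ideal if it is nonempty and its Hasse diagram is connected. A quotient $S/I$ of a polynomial ring is a complete intersection if $I$ is generated by a regular sequence (equivalently, the Krull dimension of $S/I$ equals the number of variables minus the minimal number of generators of $I$). Forests with duplications are the finite posets obtainable from one-element posets by repeated application of the following operations: (i) Disjoint union: for posets $P,Q$, take the disjoint union of the sets and of the relations, giving $P\oplus Q$. (ii) Hanging: for posets $P,Q$ and an element $a\in P$, on the disjoint union of $P$ and $Q$ add the relations $q\prec a$ for every $q\in Q$ and close transitively, giving $P\,^aQ$. (iii) Duplication: given a poset of the form $P=Q_1\,^a\,Q_2$ (obtained by hanging $Q_2$ below $a\in Q_1$) where $a$ is a minimal element of $Q_1$, add a new element $a'$ with relations $q\preceq a'$ for all $q\in Q_2$ and $a'\preceq q$ for all $q\in Q_1$ with $q\succ a$ (closed transitively), giving $P^{(a)}$.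 *)

(* Defs.v *)
From HB Require Import structures.
From mathcomp Require Import all_boot all_algebra.
From mathcomp Require Import mpoly.
Unset Printing Implicit Defensive.
Import GRing.Theory.
Local Open Scope ring_scope.

Record finposet := FinPoset { fp_sort : finType; fp_le : rel fp_sort }.

Definition is_poset (T : finType) (le : rel T) : Prop :=
  [/\ reflexive le, antisymmetric le & transitive le].

Definition lt_of (T : finType) (le : rel T) : rel T :=
  fun x y => (x != y) && le x y.

Definition order_ideal (T : finType) (le : rel T) (J : {set T}) : bool :=
  [forall y in J, forall x, le x y ==> (x \in J)].

Definition cover_in (T : finType) (le : rel T) (J : {set T}) : rel T :=
  fun x y => [&& x \in J, y \in J, lt_of T le x y &
     ~~ [exists z in J, lt_of T le x z && lt_of T le z y]].

Definition hasse_edge (T : finType) (le : rel T) (J : {set T}) : rel T :=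
  fun x y => cover_in T le J x y || cover_in T le J y x.

Definition hasse_connected (T : finType) (le : rel T) (J : {set T}) : bool :=
  [forall x in J, forall y in J, connect (hasse_edge T le J) x y].

Definition conn_ideal (T : finType) (le : rel T) (J : {set T}) : bool :=
  [&& J != set0, order_ideal T le J & hasse_connected T le J].

Definition conn_ideals (T : finType) (le : rel T) : {set {set T}} :=
  [set J : {set T} | conn_ideal T le J].

(* S = K[U_J] : variables indexed by 'I_n, n = number of connected order
   ideals, the i-th variable being U_(enum_val i).  Target ring K[t_x : x in P]
   with t_x = 'X_(enum_rank x). *)
Definition nvars (T : finType) (le : rel T) : nat := #|conn_ideals T le|.

Definition Sring (K : fieldType) (T : finType) (le : rel T) :=
  {mpoly K[nvars T le]}.

Definition t_monomial (K : fieldType) (T : finType) (J : {set T})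
  : {mpoly K[#|T|]} := \prod_(x in J) 'X_(enum_rank x).

Definition phiP (K : fieldType) (T : finType) (le : rel T)
  (p : {mpoly K[nvars T le]}) : {mpoly K[#|T|]} :=
  p \mPo [tuple t_monomial K T (enum_val (A := conn_ideals T le) i) | i < nvars T le].

Definition in_IP (K : fieldType) (T : finType) (le : rel T)
  (p : {mpoly K[nvars T le]}) : Prop := phiP K T le p = 0.

Definition in_ideal (R : comNzRingType) (fs : seq R) (p : R) : Prop :=
  exists cs : seq R, p = \sum_(i < size fs) cs`_i * fs`_i.

Definition regular_seq (R : comNzRingType) (fs : seq R) : Prop :=
  (forall i : nat, (i < size fs)%N -> forall g : R,
      in_ideal R (take i fs) (g * fs`_i) -> in_ideal R (take i fs) g)
  /\ ~ in_ideal R fs 1.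

Definition complete_intersection (R : comNzRingType) (I : R -> Prop) : Prop :=
  exists fs : seq R, regular_seq R fs /\ (forall p, I p <-> in_ideal R fs p).

Definition fp_iso (P Q : finposet) : Prop :=
  exists f : fp_sort P -> fp_sort Q,
    bijective f /\ forall x y, fp_le Q (f x) (f y) = fp_le P x y.

Definition union_le (P Q : finposet) : rel (fp_sort P + fp_sort Q)%type :=
  fun u v => match u, v with
             | inl x, inl y => fp_le P x y
             | inr x, inr y => fp_le Q x y
             | _, _ => false
             end.
Definition fp_union (P Q : finposet) : finposet :=
  @FinPoset (fp_sort P + fp_sort Q)%type (union_le P Q).

Definition hang_edge (P Q : finposet) (a : fp_sort P)
  : rel (fp_sort P + fp_sort Q)%type :=
  fun u v => union_le P Q u v ||
    match u, v with inr _, inl y => y == a | _, _ => false end.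
Definition fp_hang (P Q : finposet) (a : fp_sort P) : finposet :=
  @FinPoset (fp_sort P + fp_sort Q)%type (connect (hang_edge P Q a)).

(* duplication of (Q1 ^a Q2): new element a' (= None) with q <= a' for q in
   Q2 and a' <= q for q in Q1 with q > a, closed transitively *)
Definition dup_edge (Q1 Q2 : finposet) (a : fp_sort Q1)
  : rel (option (fp_sort Q1 + fp_sort Q2)%type) :=
  fun u v => match u, v with
    | Some u', Some v' => hang_edge Q1 Q2 a u' v'
    | Some (inr _), None => true
    | None, Some (inl q) => lt_of _ (fp_le Q1) a q
    | None, None => true
    | _, _ => false
    end.
Definition fp_dup (Q1 Q2 : finposet) (a : fp_sort Q1) : finposet :=
  @FinPoset (option (fp_sort Q1 + fp_sort Q2)%type) (connect (dup_edge Q1 Q2 a)).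

Definition minimal_in (P : finposet) (a : fp_sort P) : Prop :=
  forall q, fp_le P q a -> q = a.

Inductive forest_dup : finposet -> Prop :=
  | FD_single (P : finposet) :
      #|fp_sort P| = 1%N -> (forall x, fp_le P x x) -> forest_dup P
  | FD_iso (P Q : finposet) : forest_dup P -> fp_iso P Q -> forest_dup Q
  | FD_union (P Q : finposet) :
      forest_dup P -> forest_dup Q -> forest_dup (fp_union P Q)
  | FD_hang (P Q : finposet) (a : fp_sort P) :
      forest_dup P -> forest_dup Q -> forest_dup (fp_hang P Q a)
  | FD_dup (P Q1 Q2 : finposet) (a : fp_sort Q1) :
      forest_dup P ->
      is_poset _ (fp_le Q1) -> is_poset _ (fp_le Q2) ->
      fp_iso P (fp_hang Q1 Q2 a) -> minimal_in Q1 a ->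
      forest_dup (fp_dup Q1 Q2 a).

(* Main.v *)
(** Call two connected order ideals crossing when they meet and neither contains the other. Both
    sides of the equivalence say that every connected order ideal crosses at most one other.

    Each of the three operations preserves this property. Conversely, under this property a
    connected ideal that is not principal is a union [down x :|: down y] of two crossing principal
    ideals; the elements of [D := down x :&: down y] lie below both [x] and [y], and everything
    else lies below exactly one of them and is unrelated to [D], so the ideal is obtained from [D]
    by hanging it below [x], duplicating [x] into [y], and hanging the two remaining parts.

    If the property holds, the binomials [U_A U_B - U_(A :|: B) * \prod_C U_C], with [C] running
    over the components of [A :&: B] and [(A, B)] over the crossing pairs, have pairwise disjoint
    leading terms, and no variable of a leading term occurs in a tail. Reduction modulo these
    binomials is then an explicit linear map on monomials, which gives regularity; they generate
    [I_P] because monomials without crossing pairs of variables are determined by their degree.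

    If a regular sequence of length [r] generates [I_P], then [r] is at least the number of crossing
    pairs (look at quadratic terms), and at most the number of nonprincipal connected ideals
    ([I_P / I_P^2] is free of rank [r], and generically one relation per nonprincipal ideal
    generates [I_P]). As each nonprincipal connected ideal is the union of some crossing pair, it
    is the union of exactly one, and this forces the property. *)

Require Import Defs.
From HB Require Import structures.
From mathcomp Require Import all_boot all_algebra.
From mathcomp Require Import mpoly ssrcomplements.
From mathcomp Require Import ring.
Set Implicit Arguments.
Unset Strict Implicit.

(** * Order ideals and connectedness *)

Definition crossing (T : finType) (A B : {set T}) : bool :=
  [&& A :&: B != set0, ~~ (A \subset B) & ~~ (B \subset A)].

(** Connectedness without Hasse paths: the only splittings of [J] into two complementary order
    ideals are the trivial ones. [conn_idealP] identifies this with [conn_ideal]. *)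
Definition indec (T : finType) (le : rel T) (J : {set T}) : Prop :=
  [/\ J != set0, order_ideal T le J
    & forall I : {set T}, I \subset J -> order_ideal T le I ->
        order_ideal T le (J :\: I) -> I = set0 \/ I = J].

Definition matched (T : finType) (le : rel T) : Prop :=
  forall A B C : {set T}, indec le A -> indec le B -> indec le C ->
    crossing A B -> crossing A C -> B = C.

Definition down (T : finType) (le : rel T) (x : T) : {set T} := [set y | le y x].

Section Posets.
Variables (T : finType) (le : rel T).
Implicit Types (A B C I J : {set T}).

Lemma crossingC A B : crossing A B = crossing B A.
Proof. by rewrite /crossing setIC; congr (_ && _); apply: andbC. Qed.

Lemma crossing_meet A B : crossing A B -> A :&: B != set0.
Proof. by case/and3P. Qed.

Lemma crossingNl A B : crossing A B -> ~~ (A \subset B).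
Proof. by case/and3P. Qed.

Lemma crossingNr A B : crossing A B -> ~~ (B \subset A).
Proof. by case/and3P. Qed.

Lemma not_crossing A B x : x \in A -> x \in B -> ~~ crossing A B ->
  (A \subset B) || (B \subset A).
Proof.
move=> xA xB; rewrite /crossing.
have -> /= : A :&: B != set0 by apply/set0Pn; exists x; rewrite inE xA.
by rewrite negb_and !negbK.
Qed.

Lemma idealP J :
  reflect (forall x y, le x y -> y \in J -> x \in J) (order_ideal T le J).
Proof.
apply: (iffP forall_inP) => [H x y xy yJ|H y yJ].
  by have /forallP/(_ x) := H y yJ; rewrite xy.
by apply/forallP => x; apply/implyP => xy; apply: H xy yJ.
Qed.

Lemma idealT : order_ideal T le [set: T].
Proof. by apply/idealP => x y _; rewrite inE. Qed.

Lemma idealI A B : order_ideal T le A -> order_ideal T le B ->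
  order_ideal T le (A :&: B).
Proof.
move=> /idealP iA /idealP iB; apply/idealP => x y xy.
by rewrite !inE => /andP[yA yB]; rewrite (iA _ _ xy yA) (iB _ _ xy yB).
Qed.

Lemma idealU A B : order_ideal T le A -> order_ideal T le B ->
  order_ideal T le (A :|: B).
Proof.
move=> /idealP iA /idealP iB; apply/idealP => x y xy.
by rewrite !inE => /orP[yA|yB]; rewrite ?(iA _ _ xy yA) ?(iB _ _ xy yB) ?orbT.
Qed.

Lemma indec_ideal J : indec le J -> order_ideal T le J. Proof. by case. Qed.

Lemma indec_neq0 J : indec le J -> J != set0. Proof. by case. Qed.

(** Working form of connectedness: [J :&: I] and [J :\: I] split [J] into two ideals, and the first
    is nonempty. *)
Lemma indec_sub J I : indec le J -> order_ideal T le I ->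
  order_ideal T le (J :\: I) -> J :&: I != set0 -> J \subset I.
Proof.
move=> [J0 iJ H] iI iJI; have /H : J :&: I \subset J by apply: subsetIl.
rewrite setDIr setDv set0U => /(_ (idealI iJ iI) iJI) [->|/setIidPl //].
by rewrite eqxx.
Qed.

(** The piece of a splitting that contains a common point [z] swallows both [A] and [B]. *)
Lemma indecU A B : indec le A -> indec le B -> A :&: B != set0 ->
  indec le (A :|: B).
Proof.
move=> cA cB /set0Pn[z]; rewrite inE => /andP[zA zB].
have iA := indec_ideal cA; have iB := indec_ideal cB.
split; first by apply/set0Pn; exists z; rewrite inE zA.
  exact: idealU.
have key (I : {set T}) : I \subset A :|: B -> order_ideal T le I ->
    order_ideal T le ((A :|: B) :\: I) -> z \in I -> I = A :|: B.
  move=> sI iI iD zI; apply/eqP; rewrite eqEsubset sI subUset /=.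
  apply/andP; split.
    apply: (indec_sub cA) => //; last by apply/set0Pn; exists z; rewrite inE zA.
    have -> : A :\: I = A :&: ((A :|: B) :\: I).
      by apply/setP => w; rewrite !inE; do !case: (w \in _).
    exact: idealI.
  apply: (indec_sub cB) => //; last by apply/set0Pn; exists z; rewrite inE zB.
  have -> : B :\: I = B :&: ((A :|: B) :\: I).
    by apply/setP => w; rewrite !inE; do !case: (w \in _).
  exact: idealI.
move=> I sI iI iD; have [zI|zI] := boolP (z \in I); first by right; apply: key.
(* When [z] is not in [I], the same argument applies to the complementary piece. *)
left; have eD := setDDr (A :|: B) (A :|: B) I.
rewrite setDv set0U (setIidPr sI) in eD.
have zD : z \in (A :|: B) :\: I by rewrite !inE zI zA.
rewrite -eD.
suff -> : (A :|: B) :\: I = A :|: B by rewrite setDv.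
by apply: key; rewrite ?eD // subsetDl.
Qed.

Hypothesis posT : is_poset T le.
Let le_refl : reflexive le. Proof. by case: posT. Qed.
Let le_anti : antisymmetric le. Proof. by case: posT. Qed.
Let le_trans : transitive le. Proof. by case: posT. Qed.

Lemma mem_down x : x \in down le x. Proof. by rewrite inE. Qed.

Lemma down_sub x J : order_ideal T le J -> x \in J -> down le x \subset J.
Proof. by move=> /idealP iJ xJ; apply/subsetP => y; rewrite inE => /iJ; apply. Qed.

Lemma down_ideal x : order_ideal T le (down le x).
Proof. by apply/idealP => y z yz; rewrite !inE => /(le_trans yz). Qed.

Lemma indec_down x : indec le (down le x).
Proof.
split; [by apply/set0Pn; exists x; rewrite mem_down | exact: down_ideal |].
move=> I sI iI iD; have [xI|xI] := boolP (x \in I).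
  by right; apply/eqP; rewrite eqEsubset sI down_sub.
left; apply/eqP; rewrite -subset0; apply/subsetP => y yI.
have : y \in down le x :\: I.
  by apply: (subsetP (down_sub iD (_ : x \in _))); rewrite ?inE ?xI ?(le_refl x) //;
     have := subsetP sI y yI; rewrite inE.
by rewrite inE yI.
Qed.

(** Induction on the size of the interval from [u] to [v]: an element of [J] strictly between them
    gives two smaller intervals, and otherwise the pair is a cover. *)
Lemma hasse_connect J u v : order_ideal T le J -> le u v -> v \in J ->
  connect (hasse_edge T le J) u v.
Proof.
move=> /idealP iJ; have [n] := ubnP #|[set z | le u z & le z v]|.
elim: n u v => // n IH u v; rewrite ltnS => Hn uv vJ.
have uJ := iJ _ _ uv vJ.
have [->|neq] := eqVneq u v; first exact: connect0.
have [/existsP[z]|nz] := boolP [exists z in J, lt_of T le u z && lt_of T le z v].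
  move=> /andP[zJ /andP[/andP[uz luz] /andP[zv lzv]]].
  apply: (@connect_trans _ _ z); apply: IH => //; apply: leq_trans Hn;
    apply: proper_card; apply/properP; split.
  - by apply/subsetP => w; rewrite !inE => /andP[-> /le_trans]; apply.
  - exists v; rewrite !inE ?uv ?le_refl // negb_and; apply/orP; right.
    by apply: contra zv => vz; apply/eqP/le_anti; rewrite lzv.
  - by apply/subsetP => w; rewrite !inE => /andP[zw ->]; rewrite (le_trans luz).
  - exists u; rewrite !inE ?uv ?le_refl // negb_and; apply/orP; left.
    by apply: contra uz => zu; apply/eqP/le_anti; rewrite luz.
by apply: connect1; rewrite /hasse_edge /cover_in uJ vJ /lt_of neq uv /= nz.
Qed.

(** A piece of a splitting is closed under Hasse edges; conversely, the Hasse component of a point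
    is a piece of a splitting. *)
Lemma conn_idealP J : reflect (indec le J) (conn_ideal T le J).
Proof.
apply: (iffP and3P) => -[J0 iJ HJ]; split=> //.
  move=> I sI iI iD.
  have cl : closed (hasse_edge T le J) (mem I).
    have half x y : cover_in T le J x y -> (x \in I) = (y \in I).
      case/and4P=> xJ yJ /andP[_ xy] _; apply/idP/idP; last exact: (idealP _ iI).
      move=> xI; apply: contraLR isT => yI.
      have : x \in J :\: I by apply: (idealP _ iD _ _ xy); rewrite inE yI.
      by rewrite inE xI.
    by move=> x y /orP[/half|/half].
  have [->|/set0Pn[x xI]] := eqVneq I set0; [by left|right].
  apply/eqP; rewrite eqEsubset sI; apply/subsetP => y yJ.
  have /forall_inP/(_ x (subsetP sI _ xI))/forall_inP/(_ y yJ) := HJ.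
  by move=> /(closed_connect cl) <-.
apply/forall_inP => x xJ; apply/forall_inP => y yJ.
pose I := [set z in J | connect (hasse_edge T le J) x z].
have sym : connect_sym (hasse_edge T le J).
  by apply: sym_connect_sym => u v; rewrite /hasse_edge orbC.
have mI z : (z \in I) = (z \in J) && connect (hasse_edge T le J) x z by rewrite inE.
have [] := HJ I.
- by apply/subsetP => z; rewrite mI => /andP[].
- apply/idealP => u v uv; rewrite !mI => /andP[vJ xv].
  rewrite (idealP _ iJ _ _ uv vJ) (connect_trans xv) // sym.
  exact: hasse_connect.
- apply/idealP => u v uv; rewrite !inE => /andP[vI vJ].
  rewrite (idealP _ iJ _ _ uv vJ) andbT; move: vI; rewrite vJ /=.
  by apply: contra => xu; rewrite (connect_trans xu) // hasse_connect.
- by move/setP/(_ x); rewrite mI inE xJ connect0.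
by move=> eI; suff: y \in I; [rewrite mI => /andP[] | rewrite eI].
Qed.

End Posets.

(** * Crossing ideals *)

Section Crossings.
Variables (T : finType) (le : rel T).
Hypothesis posT : is_poset T le.
Implicit Types (A B C D J : {set T}).

Lemma crossing_intro A B x y z : x \in A -> x \notin B -> y \in B -> y \notin A ->
  z \in A -> z \in B -> crossing A B.
Proof.
move=> xA xB yB yA zA zB; apply/and3P; split.
- by apply/set0Pn; exists z; rewrite inE zA.
- by apply/negP => /subsetP/(_ _ xA); apply/negP.
- by apply/negP => /subsetP/(_ _ yB); apply/negP.
Qed.

Lemma crossingUl A B C : crossing A B -> ~~ (B \subset A :|: C) ->
  crossing (A :|: C) B.
Proof.
case/and3P=> /set0Pn[z]; rewrite inE => /andP[zA zB] AB BA nB.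
apply/and3P; split=> //; first by apply/set0Pn; exists z; rewrite !inE zA zB.
by rewrite subUset negb_and AB.
Qed.

(** Suppose [C] crosses the union and meets [A]. It does not cross [A], since it would then equal
    [B]; so it contains [A]. It then meets [B], and likewise contains [B], hence the whole union. By
    symmetry [C] meets neither. *)
Lemma matched_union A B C : matched le -> indec le A -> indec le B ->
  indec le C -> crossing A B -> ~~ crossing (A :|: B) C.
Proof.
move=> ma cA cB cC; suff key A' B' : indec le A' -> indec le B' ->
    crossing A' B' -> crossing (A' :|: B') C -> A' :&: C = set0.
  move=> xAB; apply/negP => xU; have /set0Pn[z] := crossing_meet xU.
  rewrite inE => /andP[/setUP[] zz zC].
    by have /setP/(_ z) := key A B cA cB xAB xU; rewrite !inE zz zC.
  rewrite setUC in xU; rewrite crossingC in xAB.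
  by have /setP/(_ z) := key B A cB cA xAB xU; rewrite !inE zz zC.
move=> {A B cA cB} cA cB xAB xU; apply/eqP/negPn/negP => /set0Pn[z].
rewrite inE => /andP[zA zC]; have nC := crossingNr xU.
have nxA : ~~ crossing A' C.
  apply/negP => xAC; case/negP: nC.
  by rewrite -(ma _ _ _ cA cB cC xAB xAC) subsetUr.
have [sAC|sCA] := orP (not_crossing zA zC nxA); last first.
  by case/negP: nC; apply: subset_trans sCA (subsetUl _ _).
have nxB : ~~ crossing B' C.
  apply/negP => xBC; case/negP: nC; rewrite crossingC in xAB.
  by rewrite -(ma _ _ _ cB cA cC xAB xBC) subsetUl.
have /set0Pn[w] := crossing_meet xAB; rewrite inE => /andP[wA wB].
have [sBC|sCB] := orP (not_crossing wB (subsetP sAC _ wA) nxB).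
  by case/negP: (crossingNl xU); rewrite subUset sAC.
by case/negP: nC; apply: subset_trans sCB (subsetUr _ _).
Qed.

(** If [A] crosses both [B] and [C], two crossing pairs share a union: [(A, B)] and [(A, C)], or
    [(A :|: C, B)] and [(A, B)] (or the same with [B] and [C] exchanged), or [(A :|: B, C)] and
    [(A :|: C, B)], according to which of [B], [C] lies in the union of [A] with the other. *)
Lemma matched_of_union_inj :
  (forall A B C D, indec le A -> indec le B -> indec le C -> indec le D ->
     crossing A B -> crossing C D -> A :|: B = C :|: D ->
     A = C /\ B = D \/ A = D /\ B = C) -> matched le.
Proof.
move=> inj; have key A B C : indec le A -> indec le B -> indec le C ->
    crossing A B -> crossing A C -> C \subset A :|: B -> B = C.
  move=> cA cB cC xAB xAC sC; have cAC := indecU cA cC (crossing_meet xAC).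
  have [sB|nB] := boolP (B \subset A :|: C).
    have eU : A :|: B = A :|: C.
      by apply/eqP; rewrite eqEsubset !subUset !subsetUl sB sC.
    have [[]//|[eA _]] := inj _ _ _ _ cA cB cA cC xAB xAC eU.
    by have := crossingNl xAC; rewrite eA subxx.
  have eU : (A :|: C) :|: B = A :|: B by rewrite setUAC; apply/setUidPl.
  have [[e _]|[e _]] := inj _ _ _ _ cAC cB cA cB (crossingUl xAB nB) xAB eU.
    by have := crossingNr xAC; rewrite -e subsetUr.
  by have := crossingNl xAB; rewrite -e subsetUl.
move=> A B C cA cB cC xAB xAC.
have [|nC] := boolP (C \subset A :|: B); first exact: key.
have [|nB] := boolP (B \subset A :|: C).
  by move=> sB; apply/esym; apply: key sB.
have cAC := indecU cA cC (crossing_meet xAC).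
have cAB := indecU cA cB (crossing_meet xAB).
have [[e _]|[e _]] := inj _ _ _ _ cAB cC cAC cB (crossingUl xAC nC) (crossingUl xAB nB)
  (setUAC _ _ _).
  by case/negP: nC; rewrite e subsetUr.
by have := crossingNl xAB; rewrite -e subsetUl.
Qed.

(* Take [C] of maximal size among the proper connected subideals of [J]. *)
Lemma nonprincipal_union J : indec le J -> (forall x, J != down le x) ->
  exists C z, [/\ indec le C, crossing C (down le z) & J = C :|: down le z].
Proof.
move=> cJ npJ; pose P C := conn_ideal T le C && (C \proper J).
have [x0 x0J] := set0Pn _ (indec_neq0 cJ).
have Px0 : P (down le x0).
  rewrite /P; apply/andP; split; first exact/conn_idealP/indec_down.
  by rewrite properEneq eq_sym npJ down_sub // indec_ideal.
case: (arg_maxnP (fun C : {set T} => #|C|) Px0) => C /andP[/(conn_idealP posT) cC pC] mC.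
have [/exists_inP[z zJ /set0Pn[w]]|] :=
  boolP [exists z in J :\: C, down le z :&: C != set0].
  move: zJ; rewrite !inE => /andP[zC zJ] /andP[wz wC].
  have sz : down le z \subset J by apply: down_sub => //; apply: indec_ideal.
  have eJ : J = C :|: down le z.
    have cU : indec le (C :|: down le z).
      apply: indecU => //; first exact: indec_down.
      by apply/set0Pn; exists w; rewrite !inE wC.
    have sU : C :|: down le z \subset J by rewrite subUset sz proper_sub.
    apply/eqP; rewrite eqEsubset sU andbT; apply/negPn/negP => nU.
    have /mC : P (C :|: down le z).
      by rewrite /P properE sU nU !andbT; apply/(conn_idealP posT).
    apply/negP; rewrite -ltnNge; apply: proper_card; rewrite properE subsetUl /=.
    by apply: contra zC => /subsetP; apply; rewrite in_setU (mem_down posT) orbT.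
  exists C, z; split=> //; apply/and3P; split.
  - by apply/set0Pn; exists w; rewrite !inE wC.
  - by apply: contra (npJ z) => sC; rewrite eJ; apply/eqP/setUidPr.
  - by apply/negP => /subsetP/(_ z (mem_down posT z)); apply/negP.
(* If no principal ideal generated outside [C] meets [C], then [J :\: C] is an ideal, against the
   connectedness of [J]. *)
rewrite negb_exists_in => /forall_inP nz.
have iD : order_ideal T le (J :\: C).
  apply/idealP => u v uv vD; rewrite inE (idealP _ _ (indec_ideal cJ) _ _ uv) ?andbT; last first.
    by move: vD; rewrite inE => /andP[].
  apply/negP => uC; have := nz v vD; rewrite negbK => /eqP/setP/(_ u).
  by rewrite !inE uv uC.
have sJ : J \subset C.
  apply: (indec_sub cJ _ iD); first exact: indec_ideal.
  by rewrite (setIidPr (proper_sub pC)) (indec_neq0 cC).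
by have := proper_subn pC; rewrite sJ.
Qed.

(** In the decomposition of [nonprincipal_union], a nonprincipal [C] would itself be the union of a
    crossing pair, and by [matched_union] such a union crosses nothing. *)
Lemma matched_nonprincipal J : matched le -> indec le J ->
  (forall x, J != down le x) ->
  exists x y, crossing (down le x) (down le y) /\ J = down le x :|: down le y.
Proof.
move=> ma cJ /(nonprincipal_union cJ) [C [z [cC xC eJ]]].
have [/existsP[x /eqP eC]|] := boolP [exists x, C == down le x].
  by exists x, z; rewrite -eC.
rewrite negb_exists => /forallP /(nonprincipal_union cC) [C' [z' [cC' xC' eC]]].
have := matched_union ma cC' (indec_down posT z') (indec_down posT z) xC'.
by rewrite -eC xC.
Qed.

(** * Connected components of an order ideal *)

Definition components D : {set {set T}} :=
  [set C | maxset (fun C => conn_ideal T le C && (C \subset D)) C].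

Lemma componentsP D C : reflect
  [/\ indec le C, C \subset D & forall B, indec le B -> B \subset D -> C \subset B -> B = C]
  (C \in components D).
Proof.
rewrite inE.
apply: (iffP maxsetP) => [[/andP[/(conn_idealP posT) cC sC] mC]|[cC sC mC]]; split=> //.
- by move=> B cB sB sCB; apply: mC => //; rewrite sB andbT; apply/conn_idealP.
- by rewrite sC andbT; apply/conn_idealP.
- by move=> B /andP[/(conn_idealP posT) cB sB]; apply: mC.
Qed.

Lemma component_indec D C : C \in components D -> indec le C.
Proof. by case/componentsP. Qed.

Lemma component_sub D C : C \in components D -> C \subset D.
Proof. by case/componentsP. Qed.

Lemma component_eq D B C x : B \in components D -> C \in components D ->
  x \in B -> x \in C -> B = C.
Proof.
move=> /componentsP[cB sB mB] /componentsP[cC sC mC] xB xC.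
have cU : indec le (B :|: C).
  by apply: indecU => //; apply/set0Pn; exists x; rewrite inE xB.
have sU : B :|: C \subset D by rewrite subUset sB.
by rewrite -(mB _ cU sU (subsetUl _ _)) -[RHS](mC _ cU sU (subsetUr _ _)).
Qed.

Lemma component_ex D x : order_ideal T le D -> x \in D ->
  exists2 C, C \in components D & x \in C.
Proof.
move=> iD xD; pose P C := conn_ideal T le C && (C \subset D).
have Px : P (down le x).
  by rewrite /P down_sub // andbT; apply/conn_idealP => //; apply: indec_down.
have [C mC sC] := maxset_exists Px.
by exists C; [rewrite inE | apply: (subsetP sC); apply: mem_down].
Qed.

(** The components partition an order ideal; the statement counts the components containing [x], the
    form that the degree of [tail] requires. *)
Lemma sum_components D x : order_ideal T le D ->
  (\sum_(C in components D) (x \in C) = (x \in D))%N.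
Proof.
move=> iD; have [xD|xD] := boolP (x \in D); last first.
  apply: big1 => C /component_sub sC; apply/eqP; rewrite eqb0.
  by apply: contra xD; apply/subsetP.
have [C cC xC] := component_ex iD xD.
rewrite (bigD1 C) //= xC big1 // => B /andP[cB neq]; apply/eqP; rewrite eqb0.
by apply: contra neq => xB; rewrite (component_eq cB cC xB xC).
Qed.

(** If [C] crossed [D], it could not cross [A] (it would equal [B], which contains [D]) nor contain
    [A], so it would lie in [A]; likewise in [B]. Then [D :|: C] is connected inside [A :&: B],
    against the maximality of [D]. *)
Lemma matched_component A B C D : matched le -> indec le A -> indec le B ->
  indec le C -> crossing A B -> D \in components (A :&: B) -> ~~ crossing D C.
Proof.
move=> ma cA cB cC xAB kD; have cD := component_indec kD.
have [_ sD mD] := componentsP _ _ kD; apply/negP => xDC.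
have /set0Pn[z] := crossing_meet xDC; rewrite inE => /andP[zD zC].
have sub A' B' : indec le A' -> indec le B' -> crossing A' B' ->
    D \subset A' -> D \subset B' -> C \subset A'.
  move=> cA' cB' xAB' sDA sDB.
  have nx : ~~ crossing A' C.
    apply/negP => xAC; case/negP: (crossingNl xDC).
    by rewrite -(ma _ _ _ cA' cB' cC xAB' xAC).
  have [sAC|//] := orP (not_crossing (subsetP sDA _ zD) zC nx).
  by case/negP: (crossingNl xDC); apply: subset_trans sDA sAC.
move: sD; rewrite subsetI => /andP[sDA sDB].
have sCA := sub A B cA cB xAB sDA sDB.
rewrite crossingC in xAB; have sCB := sub B A cB cA xAB sDB sDA.
have cU : indec le (D :|: C) by apply: indecU => //; apply: crossing_meet.
case/negP: (crossingNr xDC); rewrite -(mD _ cU) ?subsetUl ?subsetUr //.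
by rewrite subUset !subsetI sDA sDB sCA.
Qed.

End Crossings.

(** * Disjoint union and hanging *)

Lemma is_poset_ext (T : finType) (le le' : rel T) :
  le' =2 le -> is_poset T le -> is_poset T le'.
Proof.
move=> e [r a t]; split=> [x|x y|y x z]; rewrite !e //; [exact: a | exact: t].
Qed.

Lemma order_ideal_ext (T : finType) (le le' : rel T) (J : {set T}) :
  le =2 le' -> order_ideal T le J = order_ideal T le' J.
Proof.
by move=> e; apply/idealP/idealP => H x y; [rewrite -e | rewrite e]; apply: H.
Qed.

Lemma indec_ext (T : finType) (le le' : rel T) (J : {set T}) :
  le =2 le' -> indec le J -> indec le' J.
Proof.
move=> e [J0 iJ H]; split; rewrite -?(order_ideal_ext _ e) // => I sI.
by rewrite -!(order_ideal_ext _ e); apply: H.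
Qed.

Lemma matched_ext (T : finType) (le le' : rel T) :
  le' =2 le -> matched le -> matched le'.
Proof. by move=> e ma A B C cA cB cC; apply: ma; apply: indec_ext e _. Qed.

(** * Transport along embeddings onto order ideals *)

Section Embedding.
Variables (T T' : finType) (le : rel T) (le' : rel T') (f : T' -> T).
Hypotheses (f_inj : injective f) (f_mono : forall x y, le (f x) (f y) = le' x y)
  (f_down : forall x y, le y (f x) -> exists z, y = f z).

Lemma crossing_imset (A B : {set T'}) : crossing (f @: A) (f @: B) = crossing A B.
Proof.
rewrite /crossing -imsetI; last by move=> x y _ _; apply: f_inj.
rewrite imset_eq0; congr [&& _, ~~ _ & ~~ _]; apply/idP/idP; try exact: imsetS.
  by move/subsetP=> H; apply/subsetP => x xA; rewrite -(mem_imset _ _ f_inj) H ?imset_f.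
by move/subsetP=> H; apply/subsetP => x xA; rewrite -(mem_imset _ _ f_inj) H ?imset_f.
Qed.

(** Since the image of [f] is downward closed, a splitting of [f @: A] pulls back to a splitting of
    [A]. *)
Lemma indec_imset (A : {set T'}) : indec le' A -> indec le (f @: A).
Proof.
move=> cA; split; first by rewrite imset_eq0 (indec_neq0 cA).
  apply/idealP => x y xy /imsetP[z zA ez]; rewrite ez in xy.
  have [w ew] := f_down xy; rewrite ew f_mono in xy; rewrite ew imset_f //.
  exact: (idealP _ _ (indec_ideal cA)) xy zA.
move=> I /subsetP sI /idealP iI /idealP iD.
have [_ _ /(_ (f @^-1: I))] := cA; case.
- by apply/subsetP => x; rewrite inE => /sI; rewrite mem_imset.
- by apply/idealP => x y; rewrite !inE -f_mono; apply: iI.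
- apply/idealP => x y; rewrite -f_mono => /iD.
  by rewrite !inE !mem_imset.
- move=> /setP e; left; apply/setP => x; rewrite inE; apply/negP => xI.
  have /imsetP[y _ ex] := sI _ xI; have := e y.
  by rewrite !inE -ex xI.
- move=> /setP e; right; apply/setP => x; apply/idP/idP => [/sI //|].
  by case/imsetP=> y; rewrite -e inE => yI ->.
Qed.

Lemma matched_embed : matched le -> matched le'.
Proof.
move=> ma A B C cA cB cC; rewrite -!crossing_imset => xB xC.
by apply: (imset_inj f_inj); apply: ma xB xC; apply: indec_imset.
Qed.

Lemma is_poset_embed : is_poset T le -> is_poset T' le'.
Proof.
move=> [r a t]; split=> [x|x y|y x z]; rewrite -!f_mono //; last exact: t.
by move/a/f_inj.
Qed.

End Embedding.

Section Glue.
Variables (T1 T2 : finType) (le1 : rel T1) (le2 : rel T2) (oa : option T1).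

(* Disjoint union for [None], hanging below [a] for [Some a]. *)
Definition glue : rel (T1 + T2)%type := fun u v =>
  match u, v with
  | inl x, inl y => le1 x y
  | inr x, inr y => le2 x y
  | inr _, inl y => if oa is Some a then le1 a y else false
  | inl _, inr _ => false
  end.

Hypotheses (pos1 : is_poset T1 le1) (pos2 : is_poset T2 le2).

Lemma glue_poset : is_poset _ glue.
Proof.
case: pos1 pos2 => r1 a1 t1 [r2 a2 t2]; split.
- by case=> x /=.
- by move=> [x|x] [y|y] //=; [move/a1-> | rewrite andbF | move/a2->].
- move=> [y|y] [x|x] [z|z] //=; try exact: t1; try exact: t2.
  by case: oa => // a; apply: t1.
Qed.

(** Whether [I] contains the point below which [T2] hangs; always false for a disjoint union. *)
Let att (I : {set T1}) := if oa is Some a then a \in I else false.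

Lemma glue_att (I : {set T1}) (q : T2) y : order_ideal T1 le1 I ->
  glue (inr q) (inl y) -> y \in I -> att I.
Proof. by move=> /idealP iI; rewrite /att /=; case: oa => // a; apply: iI. Qed.

Lemma preim_inl_ideal A : order_ideal _ glue A -> order_ideal T1 le1 (inl @^-1: A).
Proof. by move=> /idealP iA; apply/idealP => x y xy; rewrite !inE; apply: iA. Qed.

Lemma preim_inr_ideal A : order_ideal _ glue A -> order_ideal T2 le2 (inr @^-1: A).
Proof. by move=> /idealP iA; apply/idealP => x y xy; rewrite !inE; apply: iA. Qed.

(** A connected ideal meeting [T1] contains all of [T2] or none of it: if it misses the hanging
    point, its part in [T1] splits off. *)
Lemma glue_inr A q : indec glue A -> inl @^-1: A != set0 :> {set T1} ->
  (inr q \in A) = att (inl @^-1: A).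
Proof.
move=> cA /set0Pn[x]; rewrite inE => xA.
have /idealP iA := indec_ideal cA; have iA1 := preim_inl_ideal (indec_ideal cA).
have [h|h] := boolP (att _).
  move: h; rewrite /att; case E: oa => [a|] //; rewrite inE => aA.
  by apply: iA aA; rewrite /= E; case: pos1.
apply/negP => qA; pose I := [set u in A | if u is inl _ then true else false].
suff /subsetP/(_ _ qA) : A \subset I by rewrite inE andbF.
apply: (indec_sub cA); last by apply/set0Pn; exists (inl x); rewrite !inE xA.
  apply/idealP => u v uv; rewrite !inE => /andP[vA].
  rewrite (iA _ _ uv vA); case: v uv vA => // y; case: u => // r uv vA _.
  by case/negP: h; apply: glue_att uv _ => //; rewrite inE.
apply/idealP => u v uv; rewrite !inE => /andP[nv vA].
rewrite (iA _ _ uv vA) andbT /=; move: nv; rewrite vA /=.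
by case: v uv {vA} => //; case: u.
Qed.

(** A splitting of the trace on [T1] extends to [A] by assigning the part in [T2] to the side of the
    hanging point. *)
Lemma indec_preim_inl A : indec glue A -> inl @^-1: A != set0 :> {set T1} ->
  indec le1 (inl @^-1: A).
Proof.
move=> cA A1; have /idealP iA := indec_ideal cA.
have iA1 := preim_inl_ideal (indec_ideal cA); split=> // I sI iI iD.
pose J := [set u in A | match u with inl x => x \in I | inr _ => att I end].
have [_ _ /(_ J)] := cA; case.
- by apply/subsetP => u; rewrite inE => /andP[].
- apply/idealP => u v uv; rewrite !inE => /andP[vA]; rewrite (iA _ _ uv vA) /=.
  case: u v uv vA => [x|q] [y|r] //= uv _; first exact: (idealP _ _ iI).
  exact: (@glue_att I q).
- apply/idealP => u v uv; rewrite !inE => /andP[nv vA].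
  rewrite (iA _ _ uv vA) andbT /=; move: nv; rewrite vA /=.
  case: u v uv vA => [x|q] [y|r] //= uv vA nv.
    have : x \in inl @^-1: A :\: I by apply: (idealP _ _ iD _ _ uv); rewrite !inE nv.
    by rewrite inE => /andP[].
  have := @glue_att (inl @^-1: A :\: I) q y iD uv; rewrite !inE nv vA => /(_ isT).
  by rewrite /att; case: oa => // a; rewrite !inE => /andP[].
- move=> /setP e; left; apply/setP => x; rewrite inE; apply/negP => xI.
  by have := e (inl x); have := subsetP sI _ xI; rewrite !inE xI => ->.
- move=> /setP e; right; apply/setP => x; rewrite !inE -e inE.
  by apply/idP/andP => [xI|[]//]; have := subsetP sI _ xI; rewrite inE.
Qed.

Lemma indec_preim_inr A : indec glue A -> inl @^-1: A = set0 :> {set T1} ->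
  indec le2 (inr @^-1: A).
Proof.
move=> cA /setP A1; have /idealP iA := indec_ideal cA.
have A1' x : inl x \in A = false by have := A1 x; rewrite !inE.
split; [|exact: preim_inr_ideal (indec_ideal cA)|].
  have /set0Pn[[x|q] qA] := indec_neq0 cA; first by rewrite A1' in qA.
  by apply/set0Pn; exists q; rewrite inE.
move=> I sI iI iD; pose J : {set T1 + T2} := [set u | if u is inr q then q \in I else false].
have [_ _ /(_ J)] := cA; case.
- by apply/subsetP => -[x|q]; rewrite inE // => /(subsetP sI); rewrite inE.
- by apply/idealP => -[x|q] [y|r] //= uv; rewrite !inE //; apply: (idealP _ _ iI).
- apply/idealP => -[x|q] [y|r] //= uv; rewrite !inE ?A1' ?andbF // => h.
  have : q \in inr @^-1: A :\: I by apply: (idealP _ _ iD _ _ uv); rewrite !inE.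
  by rewrite !inE.
- move=> /setP e; left; apply/setP => x; rewrite inE.
  by have := e (inr x); rewrite !inE.
- by move=> /setP e; right; apply/setP => x; rewrite !inE -e inE.
Qed.

Lemma glue_sub A B : indec glue A -> indec glue B ->
  inl @^-1: A != set0 :> {set T1} -> inl @^-1: B != set0 :> {set T1} ->
  (A \subset B) = (inl @^-1: A \subset (inl @^-1: B : {set T1})).
Proof.
move=> cA cB A1 B1; apply/idP/idP => [|sAB]; first exact: preimsetS.
apply/subsetP => -[x|q]; first by have := subsetP sAB x; rewrite !inE.
rewrite !glue_inr // /att; case: oa => // a; exact: (subsetP sAB).
Qed.

(** An ideal inside [T2] cannot cross [A], which contains all or nothing of [T2]. So two crossing
    ideals both meet [T1] or both lie in [T2], and the crossing is visible there. *)
Lemma glue_crossing A B : indec glue A -> indec glue B -> crossing A B ->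
  inl @^-1: A != set0 :> {set T1} ->
  inl @^-1: B != set0 :> {set T1} /\ crossing (inl @^-1: A) (inl @^-1: B : {set T1}).
Proof.
move=> cA cB xAB A1; have /set0Pn[u] := crossing_meet xAB; rewrite inE => /andP[uA uB].
have [/setP B0|B1] := eqVneq (inl @^-1: B : {set T1}) set0.
  have B0' x : inl x \in B = false by have := B0 x; rewrite !inE.
  case: u uA uB => [x|q] uA uB; first by rewrite B0' in uB.
  case/negP: (crossingNr xAB); apply/subsetP => -[x|r]; first by rewrite B0'.
  by rewrite (glue_inr r cA A1) -(glue_inr q cA A1).
split=> //; rewrite /crossing -!glue_sub // crossingNl ?crossingNr // !andbT.
case: u uA uB => [x|q]; first by move=> xA xB; apply/set0Pn; exists x; rewrite !inE xA.
(* A common element in [T2] forces the hanging point into both ideals. *)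
rewrite !glue_inr // /att; case: oa => // a; rewrite !inE => aA aB.
by apply/set0Pn; exists a; rewrite !inE aA.
Qed.

Lemma glue_crossing0 A B : indec glue A -> indec glue B -> crossing A B ->
  inl @^-1: A = set0 :> {set T1} -> inl @^-1: B = set0 :> {set T1}.
Proof.
move=> cA cB; rewrite crossingC => xAB A0; apply/eqP/negPn/negP => B1.
by have [] := glue_crossing cB cA xAB B1; rewrite A0 eqxx.
Qed.

Lemma glue_matched : matched le1 -> matched le2 -> matched glue.
Proof.
move=> m1 m2 A B C cA cB cC xB xC.
have [A0|A1] := eqVneq (inl @^-1: A : {set T1}) set0.
  have B0 := glue_crossing0 cA cB xB A0; have C0 := glue_crossing0 cA cC xC A0.
  have red D (x : T1) : inl @^-1: D = set0 :> {set T1} -> (inl x \in D) = false.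
    by move/setP/(_ x); rewrite !inE.
  have cr D : crossing A D -> inl @^-1: D = set0 :> {set T1} ->
      crossing (inr @^-1: A) (inr @^-1: D : {set T2}).
    move=> /and3P[/set0Pn[[x|z]]] + nl nr D0; rewrite !inE ?red // => zAD.
    apply/and3P; split; first by apply/set0Pn; exists z; rewrite !inE.
      by apply: contra nl => s; apply/subsetP => -[x|q]; rewrite ?red //;
        have := subsetP s q; rewrite !inE.
    by apply: contra nr => s; apply/subsetP => -[x|q]; rewrite ?red //;
        have := subsetP s q; rewrite !inE.
  have /setP e := m2 _ _ _ (indec_preim_inr cA A0) (indec_preim_inr cB B0)
    (indec_preim_inr cC C0) (cr _ xB B0) (cr _ xC C0).
  by apply/setP => -[x|q]; rewrite ?red //; have := e q; rewrite !inE.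
have [B1 xB1] := glue_crossing cA cB xB A1; have [C1 xC1] := glue_crossing cA cC xC A1.
have e := m1 _ _ _ (indec_preim_inl cA A1) (indec_preim_inl cB B1)
  (indec_preim_inl cC C1) xB1 xC1.
by apply/eqP; rewrite eqEsubset !glue_sub // e subxx.
Qed.

End Glue.

Lemma union_leE (P Q : finposet) :
  union_le P Q =2 glue (fp_le P) (fp_le Q) None.
Proof. by move=> [x|x] [y|y]. Qed.

(** Replaces the transitive closures in the definition of forests by the explicit orders [glue] and
    [dup_le]. *)
Lemma connectE (T : finType) (e le : rel T) :
  reflexive le -> transitive le -> subrel e le ->
  (forall x y, le x y -> connect e x y) -> connect e =2 le.
Proof.
move=> r t s h x y; apply/idP/idP; last exact: h.
case/connectP=> p; elim: p x => [|z p IH] x /=; first by move=> _ ->.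
by case/andP=> /s xz /IH H /H; apply: t.
Qed.

Lemma hang_leE (P Q : finposet) (a : fp_sort P) :
  is_poset _ (fp_le P) -> is_poset _ (fp_le Q) ->
  connect (hang_edge P Q a) =2 glue (fp_le P) (fp_le Q) (Some a).
Proof.
move=> posP posQ; have [r _ t] := glue_poset (Some a) posP posQ.
apply: connectE => // [[x|x] [y|y] | [x|x] [y|y]] //=; rewrite /hang_edge /= ?orbF //.
- by move/eqP->; case: posP.
- by move=> xy; apply: connect1; rewrite /hang_edge /= xy.
- move=> ay; apply: (@connect_trans _ _ (inl a)); apply: connect1.
    by rewrite /hang_edge /= eqxx.
  by rewrite /hang_edge /= ay.
- by move=> xy; apply: connect1; rewrite /hang_edge /= xy.
Qed.

(** * Duplication *)

Section Duplicate.
Variables (T1 T2 : finType) (le1 : rel T1) (le2 : rel T2) (a : T1).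
Let H := glue le1 le2 (Some a).

(** Closed form of the closure of [dup_edge] for minimal [a] (see [dup_leE]); [None] is the twin of
    [a]. *)
Definition dup_le : rel (option (T1 + T2)) := fun u v =>
  match u, v with
  | Some u', Some v' => H u' v'
  | Some u', None => if u' is inr _ then true else false
  | None, Some v' => if v' is inl y then lt_of T1 le1 a y else false
  | None, None => true
  end.

Hypotheses (pos1 : is_poset T1 le1) (pos2 : is_poset T2 le2).
Hypothesis a_min : forall q, le1 q a -> q = a.

Let posH : is_poset _ H. Proof. exact: glue_poset. Qed.
Let r1 : reflexive le1. Proof. by case: pos1. Qed.
Let t1 : transitive le1. Proof. by case: pos1. Qed.

Lemma dup_poset : is_poset _ dup_le.
Proof.
have [rH aH tH] := posH; split.
- by case=> [u|//]; exact: (rH u).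
- move=> [u|] [v|] //=; first by move/aH->.
    by case: u.
  by case: v => // y; rewrite andbF.
- move=> [v|] [u|] [w|] //=; first exact: tH.
  + by case: u v => [x|q] [y|r].
  + case: v w => // y [z|r] //= /andP[/negPf ay lay] yz.
    rewrite /lt_of (t1 lay yz) andbT; apply/eqP => az; rewrite -az in yz.
    by have := a_min yz; move/eqP; rewrite eq_sym ay.
  + by case: u w => // q [z|r] //= _ /andP[].
Qed.

Let a0 : option (T1 + T2) := Some (inl a).
Let b0 : option (T1 + T2) := None.

Section Ideal.
Variable A : {set option (T1 + T2)}.
Hypothesis cA : indec dup_le A.

Let iA u v : dup_le u v -> v \in A -> u \in A.
Proof. exact: (idealP _ _ (indec_ideal cA)). Qed.

Let above_a x : x != a -> le1 a x -> Some (inl x) \in A -> (a0 \in A) && (b0 \in A).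
Proof.
by move=> xa ax xA; rewrite (iA _ xA) ?(iA _ xA) //= /lt_of eq_sym xa.
Qed.

Let below q : (a0 \in A) || (b0 \in A) -> Some (inr q) \in A.
Proof. by case/orP; apply: iA => //=; rewrite r1. Qed.

(* The part of [A] inside [T2] and the two copies of [a] splits off. *)
Lemma dup_split : ~~ ((a0 \in A) && (b0 \in A)) ->
  [exists q, Some (inr q) \in A] || (a0 \in A) || (b0 \in A) ->
  forall x, Some (inl x) \in A -> x = a.
Proof.
move=> nab h; pose I := [set u in A | match u with
  | Some (inl x) => x == a | _ => true end].
suff /subsetP sA : A \subset I.
  by move=> x xA; have := sA _ xA; rewrite !inE => /andP[_ /eqP].
apply: (indec_sub cA).
- apply/idealP => u v uv; rewrite !inE => /andP[vA]; rewrite (iA uv vA) /=.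
  case: u v uv vA => [[x|q]|] [[y|r]|] //= xy yA /eqP ey.
  by rewrite ey in xy; rewrite (a_min xy).
- apply/idealP => u v uv; rewrite !inE => /andP[nv vA]; move: nv; rewrite vA (iA uv vA) andbT /=.
  case: u v uv vA => [[x|q]|] [[y|r]|] //= xy yA ya.
  + apply: contra nab => /eqP ex; rewrite ex in xy; exact: above_a yA.
  + by case/negP: nab; apply: above_a yA.
  + by case/negP: nab; apply: above_a yA => //; case/andP: xy.
- case/orP: h => [/orP[/existsP[q qA]|aA]|bA]; apply/set0Pn.
  + by exists (Some (inr q)); rewrite !inE qA.
  + by exists a0; rewrite in_setI aA in_set aA /= eqxx.
  + by exists b0; rewrite !inE bA.
Qed.

End Ideal.

(** Here [A] is [T2] together with the copy [s], by [dup_split]. An ideal containing [s] contains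
    [A], and one that meets [A] but contains neither copy lies in [T2], hence in [A]; so a crossing
    ideal contains exactly the other copy. *)
Lemma dup_twin A B (s t : option (T1 + T2)) : indec dup_le A -> indec dup_le B ->
  (s = a0 /\ t = b0) \/ (s = b0 /\ t = a0) ->
  crossing A B -> s \in A -> t \notin A -> (t \in B) && (s \notin B).
Proof.
move=> cA cB st xAB sA tA.
have iB := idealP _ _ (indec_ideal cB); have iA := idealP _ _ (indec_ideal cA).
have q_le (D : {set option (T1 + T2)}) q : indec dup_le D ->
    (s \in D) || (t \in D) -> Some (inr q) \in D.
  move=> cD sD; have iD := idealP _ _ (indec_ideal cD).
  by case: st sD => -[-> ->] /orP[]; apply: iD => //=; rewrite r1.
have nabA : ~~ ((a0 \in A) && (b0 \in A)).
  by case: st sA tA => -[-> ->] -> /negPf-> //; rewrite andbF.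
have eA x : Some (inl x) \in A -> x = a.
  by apply: (dup_split cA) => //; case: st sA => -[-> _] ->; rewrite ?orbT.
have subA (D : {set option (T1 + T2)}) : (forall q, Some (inr q) \in D) -> s \in D -> A \subset D.
  move=> qD sD; apply/subsetP => -[[x|q]|] // uA.
    have ex := eA x uA; rewrite ex in uA *; by case: st sA tA sD => -[-> ->] //; rewrite uA.
  by case: st sA tA sD => -[-> ->] //; rewrite uA.
have sB : s \notin B.
  apply/negP => sB; case/negP: (crossingNl xAB); apply: subA => // q.
  by apply: q_le => //; rewrite sB.
rewrite sB andbT; apply/negPn/negP => tB.
have /set0Pn[u] := crossing_meet xAB; rewrite inE => /andP[uA uB].
have nB : (a0 \notin B) && (b0 \notin B) by case: st sB tB => -[-> ->] -> ->.
have [q eu] : exists q, u = Some (inr q).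
  case: u uA uB => [[x|q]|] uA uB; last by case/andP: nB; rewrite uB.
    by move: uB; rewrite (eA x uA) => uB; case/andP: nB; rewrite uB.
  by exists q.
have eB x : Some (inl x) \in B -> x = a.
  apply: (dup_split cB); first by case/andP: nB => /negPf->.
  by apply/orP; left; apply/orP; left; apply/existsP; exists q; rewrite -eu.
case/negP: (crossingNr xAB); apply/subsetP => -[[x|r]|] // vB.
- by move: (vB); rewrite (eB x vB) => aB; case/andP: nB; rewrite aB.
- by apply: q_le => //; rewrite sA.
- by case/andP: nB; rewrite vB.
Qed.

(** Such an ideal can only be [T2] together with [s]. *)
Lemma dup_one (A B : {set option (T1 + T2)}) (s t : option (T1 + T2)) :
  indec dup_le A -> indec dup_le B ->
  (s = a0 /\ t = b0) \/ (s = b0 /\ t = a0) ->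
  s \in A -> t \notin A -> s \in B -> t \notin B -> A = B.
Proof.
move=> cA cB st sA tA sB tB.
have key (C D : {set option (T1 + T2)}) : indec dup_le C -> indec dup_le D ->
    s \in C -> t \notin C -> s \in D -> C \subset D.
  move=> cC cD sC tC sD; have iD := idealP _ _ (indec_ideal cD).
  have nab : ~~ ((a0 \in C) && (b0 \in C)).
    by case: st sC tC => -[-> ->] -> /negPf-> //; rewrite andbF.
  have eC x : Some (inl x) \in C -> x = a.
    by apply: (dup_split cC) => //; case: st sC => -[-> _] ->; rewrite ?orbT.
  apply/subsetP => -[[x|q]|] uC.
  - have ex := eC x uC; rewrite ex in uC *; by case: st sC tC sD => -[-> ->] //; rewrite uC.
  - by case: st sD => -[-> _]; apply: iD => //=; rewrite r1.
  - by case: st sC tC sD => -[-> ->] //; rewrite uC.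
by apply/eqP; rewrite eqEsubset !key.
Qed.

Lemma dup_sub (A B : {set option (T1 + T2)}) : (a0 \in A) = (b0 \in A) -> (a0 \in B) = (b0 \in B) ->
  (A \subset B) = (Some @^-1: A \subset (Some @^-1: B : {set T1 + T2})).
Proof.
move=> eA eB; apply/idP/idP => [|sAB]; first exact: preimsetS.
have sS u : Some u \in A -> Some u \in B by have := subsetP sAB u; rewrite !inE.
by apply/subsetP => -[u|]; [apply: sS | rewrite -eA -eB; apply: sS].
Qed.

(** A splitting of the trace on the undoubled poset extends to [A] by putting the twin on the side
    of [a]. *)
Lemma dup_indec_preim A : indec dup_le A -> (a0 \in A) = (b0 \in A) ->
  indec H (Some @^-1: A).
Proof.
move=> cA eA; have iA := idealP _ _ (indec_ideal cA); split.
- have /set0Pn[[u|] uA] := indec_neq0 cA; apply/set0Pn; first by exists u; rewrite inE.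
  by exists (inl a); rewrite inE eA.
- by apply/idealP => u v uv; rewrite !inE; exact: (iA (Some u) (Some v) uv).
move=> I sI iI iD; pose J := [set u in A | match u with
  | Some u' => u' \in I | None => inl a \in I end].
have [_ _ /(_ J)] := cA; case.
- by apply/subsetP => u; rewrite inE => /andP[].
- apply/idealP => u v uv; rewrite !inE => /andP[vA]; rewrite (iA _ _ uv vA) /=.
  case: u v uv vA => [u|] [v|] //= uv _; first exact: (idealP _ _ iI).
    case: u uv => // q _; apply: (idealP _ _ iI) => /=; exact: r1.
  by case: v uv => // y /andP[_ ay]; apply: (idealP _ _ iI).
- apply/idealP => u v uv; rewrite !inE => /andP[nv vA].
  rewrite (iA _ _ uv vA) andbT /=; move: nv; rewrite vA /=.
  have D w z : H w z -> z \notin I -> Some z \in A -> w \notin I.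
    move=> wz nz zA; have : w \in Some @^-1: A :\: I.
      by apply: (idealP _ _ iD _ _ wz); rewrite !inE nz.
    by rewrite inE => /andP[].
  case: u v uv vA => [u|] [v|] //= uv vA nv; first exact: D uv nv vA.
    by case: u uv => // q _; apply: D nv _; rewrite ?eA //=; apply: r1.
  by case: v uv vA nv => // y /andP[_ ay] vA nv; apply: D nv vA.
- move=> /setP e; left; apply/setP => x; rewrite inE; apply/negP => xI.
  by have := e (Some x); have := subsetP sI _ xI; rewrite !inE xI => ->.
- move=> /setP e; right; apply/setP => x; rewrite !inE -e inE.
  by apply/idP/andP => [xI|[]//]; have := subsetP sI _ xI; rewrite inE.
Qed.

Lemma dup_crossing (A B : {set option (T1 + T2)}) :
  (a0 \in A) = (b0 \in A) -> (a0 \in B) = (b0 \in B) ->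
  crossing A B -> crossing (Some @^-1: A) (Some @^-1: B : {set T1 + T2}).
Proof.
move=> eA eB /and3P[/set0Pn[u]]; rewrite inE => /andP[uA uB] nl nr.
rewrite /crossing -!dup_sub // nl nr !andbT; apply/set0Pn.
by case: u uA uB => [u|] uA uB; [exists u | exists (inl a)]; rewrite !inE ?eA ?eB ?uA.
Qed.

(** An ideal with exactly one copy of [a] crosses only ideals with exactly the other copy, and there
    is at most one of those. An ideal with both copies or neither crosses only ideals of the same
    type, whose crossings are those of their traces on [H]. *)
Lemma dup_matched : matched H -> matched dup_le.
Proof.
move=> mH; have one s t A B C : (s = a0 /\ t = b0) \/ (s = b0 /\ t = a0) ->
    indec dup_le A -> indec dup_le B -> indec dup_le C ->
    crossing A B -> crossing A C -> s \in A -> t \notin A -> B = C.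
  move=> st cA cB cC xB xC sA tA.
  have /andP[tB sB] := dup_twin cA cB st xB sA tA.
  have /andP[tC sC] := dup_twin cA cC st xC sA tA.
  apply: (@dup_one _ _ t s) => //; tauto.
have both A B : indec dup_le A -> indec dup_le B -> crossing A B ->
    (a0 \in A) = (b0 \in A) -> (a0 \in B) = (b0 \in B).
  rewrite crossingC => cA cB xBA eA.
  have [aB|aB] := boolP (a0 \in B); have [bB|bB] := boolP (b0 \in B) => //.
    have /andP[bA] := dup_twin cB cA (or_introl (conj erefl erefl)) xBA aB bB.
    by rewrite eA bA.
  have /andP[aA] := dup_twin cB cA (or_intror (conj erefl erefl)) xBA bB aB.
  by rewrite -eA aA.
move=> A B C cA cB cC xB xC.
have [aA|aA] := boolP (a0 \in A); have [bA|bA] := boolP (b0 \in A).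
- have eA : (a0 \in A) = (b0 \in A) by rewrite aA.
  have eB := both _ _ cA cB xB eA; have eC := both _ _ cA cC xC eA.
  have e := mH _ _ _ (dup_indec_preim cA eA) (dup_indec_preim cB eB)
    (dup_indec_preim cC eC) (dup_crossing eA eB xB) (dup_crossing eA eC xC).
  by apply/eqP; rewrite eqEsubset !dup_sub // e subxx.
- exact: (one a0 b0 A B C (or_introl (conj erefl erefl))).
- exact: (one b0 a0 A B C (or_intror (conj erefl erefl))).
- have eA : (a0 \in A) = (b0 \in A) by rewrite (negPf aA) (negPf bA).
  have eB := both _ _ cA cB xB eA; have eC := both _ _ cA cC xC eA.
  have e := mH _ _ _ (dup_indec_preim cA eA) (dup_indec_preim cB eB)
    (dup_indec_preim cC eC) (dup_crossing eA eB xB) (dup_crossing eA eC xC).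
  by apply/eqP; rewrite eqEsubset !dup_sub // e subxx.
Qed.

End Duplicate.

Lemma dup_leE (P Q : finposet) (a : fp_sort P) :
  is_poset _ (fp_le P) -> is_poset _ (fp_le Q) -> minimal_in P a ->
  connect (dup_edge P Q a) =2 dup_le (fp_le P) (fp_le Q) a.
Proof.
move=> posP posQ mina; have [r _ t] := dup_poset posP posQ mina.
apply: connectE => //.
  move=> [u|] [v|] //= uv.
  have {}uv : hang_edge P Q a u v by case: u uv.
  by rewrite -(hang_leE a posP posQ); apply: connect1.
move=> [u|] [v|] //=.
- rewrite -(hang_leE a posP posQ) => /connectP[p]; elim: p u => [|w p IH] u /=.
    by move=> _ ->.
  move=> /andP[uw /IH pw] /pw; apply: connect_trans; apply: connect1.
  by case: u uw.
- by case: u => // q _; apply: connect1.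
- by case: v => // y ay; apply: connect1.
Qed.

Lemma fp_iso_matched (P Q : finposet) : fp_iso P Q ->
  is_poset _ (fp_le P) -> matched (fp_le P) ->
  is_poset _ (fp_le Q) /\ matched (fp_le Q).
Proof.
move=> [f [[g fK gK] fm]] posP mP.
have gm x y : fp_le P (g x) (g y) = fp_le Q x y by rewrite -fm !gK.
split; first exact: is_poset_embed (can_inj gK) gm posP.
by apply: matched_embed (can_inj gK) gm _ mP => x y _; exists (f y).
Qed.

Lemma forest_dup_matched P : forest_dup P ->
  is_poset _ (fp_le P) /\ matched (fp_le P).
Proof.
elim=> {P} [P P1 r|P Q _ [posP mP] iPQ|P Q _ [posP mP] _ [posQ mQ]
  |P Q a _ [posP mP] _ [posQ mQ]|P Q1 Q2 a _ [posP mP] pos1 pos2 iPH mina].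
- have /fintype1P[x0 x0P] : #|fp_sort P| == 1%N by apply/eqP.
  have e x y : x = y :> fp_sort P by rewrite (x0P x) (x0P y).
  split; first by split=> [x|x y _|y x z _ _]; rewrite ?r ?(e x z).
  move=> A B C _ /indec_neq0/set0Pn[y yB] _ /crossingNl/negP[].
  by apply/subsetP => x _; rewrite (e x y).
- exact: fp_iso_matched iPQ posP mP.
- split; first exact: is_poset_ext (@union_leE P Q) (glue_poset _ posP posQ).
  exact: matched_ext (@union_leE P Q) (glue_matched posP mP mQ).
- have e := hang_leE a posP posQ; split.
    exact: is_poset_ext e (glue_poset _ posP posQ).
  exact: matched_ext e (glue_matched posP mP mQ).
(* Only the hung poset is known to satisfy the crossing condition, which is transported along the
   isomorphism. *)
- have [_ mH] := fp_iso_matched iPH posP mP.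
  have e := dup_leE pos1 pos2 mina; split.
    exact: is_poset_ext e (dup_poset pos1 pos2 mina).
  apply: matched_ext e _; apply: dup_matched => //; apply: matched_ext mH => x y.
  exact: esym (hang_leE _ pos1 pos2 x y).
Qed.

(** * Building the poset from the crossing condition *)

Definition unit_poset : finposet := @FinPoset unit (fun _ _ => true).

Lemma unit_posetP : is_poset _ (fp_le unit_poset).
Proof. by split=> [||? ? ?] // [] []. Qed.

Lemma forest_dup_unit : forest_dup unit_poset.
Proof. by apply: FD_single => //; rewrite card_unit. Qed.

Section Construct.
Variables (T : finType) (le : rel T).
Hypothesis posT : is_poset T le.
Implicit Types (S D : {set T}).

Let le_refl : reflexive le. Proof. by case: posT. Qed.
Let le_anti : antisymmetric le. Proof. by case: posT. Qed.
Let le_trans : transitive le. Proof. by case: posT. Qed.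

Definition sub_poset S : finposet :=
  @FinPoset {x | x \in S} (fun u v => le (val u) (val v)).

Lemma sub_posetP S : is_poset _ (fp_le (sub_poset S)).
Proof. exact: (@is_poset_embed _ _ le _ _ val_inj). Qed.

Lemma fp_iso_sub_setT : fp_iso (sub_poset [set: T]) (FinPoset T le).
Proof.
exists val; split=> //; apply: inj_card_bij; first exact: val_inj.
by rewrite card_sig; apply/eq_leq/eq_card => x; rewrite !inE.
Qed.

Lemma sub_bij (Q : finposet) S (g : fp_sort Q -> T) : injective g ->
  (forall u, g u \in S) -> #|S| <= #|fp_sort Q| ->
  (forall u v, le (g u) (g v) = fp_le Q u v) -> fp_iso Q (sub_poset S).
Proof.
move=> gi gS cS gm; exists (fun u => exist _ (g u) (gS u)); split=> //.
apply: inj_card_bij; first by move=> u v [/gi].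
by rewrite card_sig.
Qed.

Definition sum_val S D (u : {x | x \in S} + {x | x \in D}) : T :=
  match u with inl s => val s | inr d => val d end.

Lemma sum_val_in S D u : @sum_val S D u \in S :|: D.
Proof. by case: u => -[x xS] /=; rewrite inE xS ?orbT. Qed.

Lemma sum_val_inj S D : [disjoint S & D] -> injective (@sum_val S D).
Proof.
move=> dSD [[x xS]|[x xD]] [[y yS]|[y yD]] /= e.
- by congr inl; apply: val_inj.
- by suff: false by []; rewrite -(disjointFl dSD yD) -e.
- by suff: false by []; rewrite -(disjointFl dSD xD) e.
- by congr inr; apply: val_inj.
Qed.

Lemma card_sum_val S D : #|S :|: D| <= #|{: {x | x \in S} + {x | x \in D}}|.
Proof. by rewrite card_sum !card_sig cardsU leq_subr. Qed.

Lemma forest_dup_sub_union S D : [disjoint S & D] ->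
  (forall x y, x \in S -> y \in D -> ~~ le x y /\ ~~ le y x) ->
  forest_dup (sub_poset S) -> forest_dup (sub_poset D) ->
  forest_dup (sub_poset (S :|: D)).
Proof.
move=> dSD sep fS fD; apply: (FD_iso _ _ (FD_union _ _ fS fD)).
apply: (@sub_bij (fp_union (sub_poset S) (sub_poset D)) _ (@sum_val S D)).
- exact: sum_val_inj.
- exact: sum_val_in.
- exact: card_sum_val.
by move=> [[x xS]|[x xD]] [[y yS]|[y yD]] //=; apply/negbTE;
   [case: (sep _ _ xS yD) | case: (sep _ _ yS xD)].
Qed.

(** The order condition says that [D] hangs below [z]. Forests with duplications are nonempty, so an
    empty [D] is allowed separately. *)
Lemma forest_dup_sub_hang S D z : [disjoint S & D] -> z \in S ->
  (forall d s, d \in D -> s \in S -> ~~ le s d /\ le d s = le z s) ->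
  forest_dup (sub_poset S) -> D = set0 \/ forest_dup (sub_poset D) ->
  forest_dup (sub_poset (S :|: D)).
Proof.
move=> dSD zS sep fS [->|fD]; first by rewrite setU0.
apply: (FD_iso _ _ (FD_hang _ _ (exist _ z zS : fp_sort (sub_poset S)) fS fD)).
apply: (@sub_bij (fp_hang (sub_poset S) (sub_poset D) _) _ (@sum_val S D)).
- exact: sum_val_inj.
- exact: sum_val_in.
- exact: card_sum_val.
move=> u v; rewrite /= (hang_leE _ (sub_posetP S) (sub_posetP D)).
move: u v => [[x xS]|[x xD]] [[y yS]|[y yD]] //=.
  by apply/negbTE; case: (sep _ _ yD xS).
by case: (sep _ _ xD yS).
Qed.

Lemma forest_dup_sub1 m : forest_dup (sub_poset [set m]).
Proof. by apply: FD_single => [|x] /=; rewrite ?card_sig ?cards1. Qed.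

(** [D] is hung below a one-point poset, and the point is then duplicated. *)
Lemma forest_dup_sub_twins D x y : x \notin D -> y \notin D -> ~~ le x y -> ~~ le y x ->
  (forall d, d \in D -> [/\ le d x, le d y, ~~ le x d & ~~ le y d]) ->
  forest_dup (sub_poset D) -> forest_dup (sub_poset ([set x; y] :|: D)).
Proof.
move=> xD yD xy yx hD fD.
have mina : @minimal_in unit_poset tt by case.
have fH := FD_hang _ _ (tt : fp_sort unit_poset) forest_dup_unit fD.
have rf : fp_iso (fp_hang unit_poset (sub_poset D) tt) (fp_hang unit_poset (sub_poset D) tt).
  by exists id; split=> //; exists id.
apply: (FD_iso _ _ (FD_dup _ _ _ _ fH unit_posetP (sub_posetP D) rf mina)).
pose g (u : option (unit + {x | x \in D})) := match u with
  | None => y | Some (inl _) => x | Some (inr d) => val d end.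
have xy' : x != y by apply: contraNneq xy => ->.
apply: (@sub_bij (fp_dup unit_poset (sub_poset D) tt) _ g).
- move=> [[[]|[d dD]]|] [[[]|[e eD]]|] //= h.
  + by move: xD; rewrite h eD.
  + by rewrite h eqxx in xy'.
  + by move: xD; rewrite -h dD.
  + by congr (Some (inr _)); apply: val_inj.
  + by move: yD; rewrite -h dD.
  + by rewrite h eqxx in xy'.
  + by move: yD; rewrite h eD.
- by case=> [[[]|[d dD]]|]; rewrite !inE ?eqxx ?orbT //= dD !orbT.
- rewrite card_option card_sum card_unit card_sig.
  rewrite (leq_trans (leq_card_setU _ _)) // cards2 xy'.
  by rewrite add1n add2n.
move=> u v; rewrite /= (dup_leE unit_posetP (sub_posetP D) mina).
move: u v => [[[]|[d dD]]|] [[[]|[e eD]]|] //=; rewrite ?le_refl ?(negPf xy) ?(negPf yx) //.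
- by have [_ _ /negbTE] := hD e eD.
- by have [] := hD d dD.
- by have [] := hD d dD.
- by have [_ _ _ /negbTE] := hD e eD.
Qed.

Hypothesis mT : matched le.

(** Induction on the size of [S]: a disconnected ideal loses a component, a principal one loses its
    top element, and any other is a union of two crossing principal ideals. *)
Lemma forest_dup_sub_ideal S : order_ideal T le S -> S != set0 ->
  forest_dup (sub_poset S).
Proof.
have [n] := ubnP #|S|; elim: n S => // n IH S; rewrite ltnS => Sn iS S0.
have IHo D : order_ideal T le D -> D \proper S -> D = set0 \/ forest_dup (sub_poset D).
  move=> iD pD; have [->|D0] := eqVneq D set0; [by left | right].
  by apply: IH => //; apply: leq_trans (proper_card pD) Sn.
have /idealP iS' := iS.
have [/(conn_idealP posT) cS|ncS] := boolP (conn_ideal T le S); last first.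
  have /set0Pn[x xS] := S0; have [C kC xC] := component_ex posT iS xS.
  have cC := component_indec posT kC; have iC := indec_ideal cC.
  have sC := component_sub posT kC.
  have iD : order_ideal T le (S :\: C).
    apply/idealP => u v uv; rewrite !inE => /andP[vC vS].
    rewrite (iS' _ _ uv vS) andbT; apply: contra vC => uC.
    have [E kE vE] := component_ex posT iS vS.
    have uE : u \in E.
      exact: (idealP _ _ (indec_ideal (component_indec posT kE)) _ _ uv).
    by rewrite (component_eq posT kC kE uC uE).
  have pC : C \proper S.
    rewrite properEneq sC andbT; apply: contraNneq ncS => <-.
    exact/(conn_idealP posT).
  have pD : S :\: C \proper S.
    apply/properP; split; first exact: subsetDl.
    by exists x => //; rewrite !inE xC.
  have e : C :|: (S :\: C) = S by rewrite -{1}(setIidPr sC) setID.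
  have [C0|fC] := IHo _ iC pC; first by rewrite C0 inE in xC.
  have [D0|fD] := IHo _ iD pD; first by rewrite -e D0 setU0.
  rewrite -e; apply: forest_dup_sub_union => //.
    by rewrite disjoints_subset; apply/subsetP => u uC; rewrite !inE uC.
  move=> u v uC vD; move: (vD); rewrite inE => /andP[vC _]; split.
    apply/negP => uv; have := idealP _ _ iD _ _ uv vD.
    by rewrite inE uC.
  by apply: contra vC => vu; apply: (idealP _ _ iC) vu uC.
have [/existsP[m /eqP eS]|] := boolP [exists m, S == down le m].
  have e : [set m] :|: (S :\ m) = S by rewrite setD1K // eS mem_down.
  rewrite -e; apply: (@forest_dup_sub_hang _ _ m); rewrite ?set11 //.
  - by rewrite disjoints1 !inE eqxx.
  - move=> d s; rewrite eS !inE => /andP[dm dlem] /eqP->; rewrite dlem le_refl; split=> //.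
    by apply: contra dm => md; apply/eqP/le_anti; rewrite dlem.
  - exact: forest_dup_sub1.
  apply: IHo; last by rewrite properD1 // eS mem_down.
  apply/idealP => u v uv; rewrite eS !inE => /andP[vm vlem].
  rewrite (le_trans uv vlem) andbT; apply: contra vm => /eqP um.
  by rewrite um in uv; apply/eqP/le_anti; rewrite vlem.
rewrite negb_exists => /forallP /(matched_nonprincipal posT mT cS) [x [y [xB eS]]].
have xy : ~~ le x y.
  apply: contra (crossingNl xB) => xy; apply/subsetP => u.
  by rewrite !inE => /le_trans; apply.
have yx : ~~ le y x.
  apply: contra (crossingNr xB) => yx; apply/subsetP => u.
  by rewrite !inE => /le_trans; apply.
pose D := down le x :&: down le y.
have iD : order_ideal T le D by apply: idealI; apply: down_ideal.
pose side a b : {set T} := [set u | [&& le u a, u != a & ~~ le u b]].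
(* An element of [side a b] above some element of [D] would generate an ideal crossing [down b]. *)
have sideP a b : crossing (down le a) (down le b) ->
    forall u d, u \in side a b -> d \in down le a :&: down le b -> ~~ le d u.
  move=> xab u d; rewrite !inE => /and3P[ua nua nub] /andP[da db].
  apply/negP => du; have xu : crossing (down le b) (down le u).
    apply: (@crossing_intro _ _ _ b u d); rewrite ?inE ?le_refl //.
    apply: contra (crossingNr xab) => bu; apply/subsetP => w; rewrite !inE.
    by move/le_trans/(_ (le_trans bu ua)).
  rewrite crossingC in xab.
  have := mT (indec_down posT b) (indec_down posT a) (indec_down posT u) xab xu.
  move/setP/(_ a); rewrite !inE le_refl => /esym au.
  by case/negP: nua; apply/eqP/le_anti; rewrite ua.
have side_ideal a b : crossing (down le a) (down le b) -> order_ideal T le (side a b).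
  move=> xab; apply/idealP => u v uv vS; move: (vS); rewrite !inE => /and3P[va nva nvb].
  rewrite (le_trans uv va) /=; apply/andP; split.
    apply: contra nva => /eqP ua; rewrite ua in uv.
    by apply/eqP/le_anti; rewrite va.
  apply/negP => ub; have := sideP _ _ xab _ u vS.
  by rewrite uv !inE ub (le_trans uv va) => /(_ isT).
have side_proper a b : down le a \subset S -> a \in S -> side a b \proper S.
  move=> sa aS; apply/properP; split; last by exists a; rewrite ?inE ?eqxx ?andbF.
  by apply: subset_trans sa; apply/subsetP => u; rewrite !inE => /and3P[].
have sx : down le x \subset S by rewrite eS subsetUl.
have sy : down le y \subset S by rewrite eS subsetUr.
have xS : x \in S by apply: (subsetP sx); apply: mem_down.
have yS : y \in S by apply: (subsetP sy); apply: mem_down.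
have xD : x \notin D by rewrite !inE negb_and xy orbT.
have yD : y \notin D by rewrite !inE negb_and yx.
have xB' : crossing (down le y) (down le x) by rewrite crossingC.
(* Order of construction: [D] with the twins [x] and [y] on top, then the elements only below [x],
   then those only below [y]. *)
have e : (([set x; y] :|: D) :|: side x y) :|: side y x = S.
  apply/setP => u; rewrite eS !inE.
  have [->|nx] := eqVneq u x; first by rewrite le_refl.
  have [->|ny] := eqVneq u y; first by rewrite le_refl !orbT.
  by case: (le u x); case: (le u y).
rewrite -e; apply: (@forest_dup_sub_hang _ _ y).
- rewrite disjoints_subset; apply/subsetP => u; rewrite !inE.
  have [->|nx] := eqVneq u x; first by rewrite (negPf xy).
  have [->|ny] := eqVneq u y; first by rewrite andbF.
  by case: (le u x); case: (le u y).
- by rewrite !inE eqxx orbT.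
- move=> d s dS; have := dS; rewrite !inE => /and3P[dy ndy ndx].
  case/orP=> [/orP[/orP[]/eqP->|/andP[sx' sy']]|/and3P[sx' nsx nsy]].
  + rewrite (negPf ndx) (negPf yx); split=> //.
    by apply: contra xy => /le_trans; apply.
  + rewrite dy le_refl; split=> //; apply: contra ndy => yd.
    by apply/eqP/le_anti; rewrite dy.
  + split; first by apply: (sideP _ _ xB' _ _ dS); rewrite !inE sx' sy'.
    have -> : le y s = false by apply: contraNF yx => /le_trans; apply.
    by apply: contraNF ndx => /le_trans; apply.
  + split; first by apply: contra nsy => /le_trans; apply.
    have -> : le y s = false by apply: contraNF yx => /le_trans; apply.
    by apply: contraNF ndx => /le_trans; apply.
- apply: (@forest_dup_sub_hang _ _ x).
  + rewrite disjoints_subset; apply/subsetP => u; rewrite !inE.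
    have [->|nx] := eqVneq u x; first by rewrite /= andbF.
    have [->|ny] := eqVneq u y; first by rewrite (negPf yx).
    by case: (le u x); case: (le u y).
  + by rewrite !inE eqxx.
  + move=> d s dS; have := dS; rewrite !inE => /and3P[dx ndx ndy].
    case/orP=> [/orP[]/eqP->|/andP[sx' sy']].
    * rewrite dx le_refl; split=> //; apply: contra ndx => xd.
      by apply/eqP/le_anti; rewrite dx.
    * rewrite (negPf ndy) (negPf xy); split=> //.
      by apply: contra yx => /le_trans; apply.
    * split; first by apply: (sideP _ _ xB _ _ dS); rewrite !inE sx' sy'.
      have -> : le x s = false by apply: contraNF xy => /le_trans; apply.
      by apply: contraNF ndy => /le_trans; apply.
  + apply: forest_dup_sub_twins => //.
      move=> d; rewrite !inE => /andP[dx dy]; split=> //.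
        by apply: contra xy => /le_trans; apply.
      by apply: contra yx => /le_trans; apply.
    have [|D0|//] := IHo _ iD.
      apply/properP; split; first exact: subset_trans (subsetIl _ _) sx.
      by exists x.
    by have := crossing_meet xB; rewrite -/D D0 eqxx.
  + by apply: IHo; [apply: side_ideal | apply: side_proper].
- by apply: IHo; [apply: side_ideal | apply: side_proper].
Qed.

Lemma matched_forest_dup : 0 < #|T| -> forest_dup (FinPoset T le).
Proof.
move=> T0; apply: (FD_iso _ _ _ fp_iso_sub_setT); apply: forest_dup_sub_ideal.
  exact: idealT.
by apply/set0Pn; have /card_gt0P[x _] := T0; exists x.
Qed.

End Construct.

(** * Ideals generated by sequences; monomial maps *)
Import GRing.Theory.
Local Open Scope ring_scope.

Section Ideals.
Variable R : comNzRingType.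
Implicit Types (fs gs : seq R) (f p q : R).

Lemma in_idealP fs p : in_ideal R fs p <->
  exists c : nat -> R, p = \sum_(i < size fs) c i * fs`_i.
Proof.
split=> [[cs ->]|[c ->]]; first by exists (fun i => cs`_i).
by exists (mkseq c (size fs)); apply: eq_bigr => i _; rewrite nth_mkseq.
Qed.

Lemma in_ideal0 fs : in_ideal R fs 0.
Proof. by apply/in_idealP; exists (fun=> 0); rewrite big1 // => i _; rewrite mul0r. Qed.

Lemma in_idealD fs p q : in_ideal R fs p -> in_ideal R fs q -> in_ideal R fs (p + q).
Proof.
move=> /in_idealP[c ->] /in_idealP[d ->]; apply/in_idealP; exists (fun i => c i + d i).
by rewrite -big_split; apply: eq_bigr => i _; rewrite mulrDl.
Qed.

Lemma in_idealMl fs p q : in_ideal R fs q -> in_ideal R fs (p * q).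
Proof.
move=> /in_idealP[c ->]; apply/in_idealP; exists (fun i => p * c i).
by rewrite big_distrr; apply: eq_bigr => i _; rewrite /= mulrA.
Qed.

Lemma in_idealB fs p q : in_ideal R fs p -> in_ideal R fs q -> in_ideal R fs (p - q).
Proof. by move=> pI qI; rewrite -mulN1r; apply/in_idealD/in_idealMl. Qed.

Lemma in_ideal_sum (I : Type) (r : seq I) (P : pred I) (F : I -> R) fs :
  (forall i, P i -> in_ideal R fs (F i)) -> in_ideal R fs (\sum_(i <- r | P i) F i).
Proof. by move=> FI; elim/big_rec: _ => [|i x /FI]; [apply: in_ideal0 | apply: in_idealD]. Qed.

Lemma in_ideal_nth fs i : (i < size fs)%N -> in_ideal R fs fs`_i.
Proof.
move=> lti; apply/in_idealP; exists (fun j => (j == i)%:R).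
rewrite (bigD1 (Ordinal lti)) //= eqxx mul1r big1 ?addr0 // => j nj.
by rewrite -val_eqE /= in nj; rewrite (negPf nj) mul0r.
Qed.

Lemma in_ideal_mem fs f : f \in fs -> in_ideal R fs f.
Proof. by move=> /(nthP 0)[i lti <-]; apply: in_ideal_nth. Qed.

Lemma in_ideal_incl fs gs p : (forall f, f \in fs -> in_ideal R gs f) ->
  in_ideal R fs p -> in_ideal R gs p.
Proof.
move=> sub /in_idealP[c ->]; apply: in_ideal_sum => i _.
by apply/in_idealMl/sub/mem_nth.
Qed.

Lemma in_ideal_cons f fs p : in_ideal R (f :: fs) p ->
  exists c q, p = c * f + q /\ in_ideal R fs q.
Proof.
move=> /in_idealP[c ->]; rewrite big_ord_recl /=; do 2!eexists; split=> //.
by apply/in_idealP; exists (fun i => c i.+1).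
Qed.

(* The syzygies of a regular sequence are generated by the Koszul relations. *)
Lemma regular_syzygy fs (c : nat -> R) : regular_seq R fs ->
  \sum_(i < size fs) c i * fs`_i = 0 ->
  forall i, (i < size fs)%N -> in_ideal R fs (c i).
Proof.
move=> [reg _]; suff key k : (k <= size fs)%N -> forall c : nat -> R,
    \sum_(i < k) c i * fs`_i = 0 -> forall i, (i < k)%N -> in_ideal R (take k fs) (c i).
  by move=> e i lti; rewrite -[fs in in_ideal _ fs]take_size; apply: key.
elim: k => {c} [|k IH] ltk c //; rewrite big_ord_recr /= => e.
have szk : size (take k fs) = k by rewrite size_takel // ltnW.
(* Regularity at index [k] writes the last coefficient in terms of the earlier generators. *)
have [b eb] : in_ideal R (take k fs) (c k).
  apply: reg => //; apply/in_idealP; exists (fun i => - c i).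
  move/eqP: e; rewrite szk addrC addr_eq0 => /eqP ->; rewrite -sumrN.
  by apply: eq_bigr => i _; rewrite nth_take // mulNr.
have sub p : in_ideal R (take k fs) p -> in_ideal R (take k.+1 fs) p.
  apply: in_ideal_incl => f; rewrite (take_nth 0) // => ff.
  by apply: in_ideal_mem; rewrite mem_rcons inE ff orbT.
rewrite szk in eb.
(* The last term is absorbed into the others, which leaves a shorter syzygy. *)
have e' : \sum_(i < k) (c i + b`_i * fs`_k) * fs`_i = 0.
  rewrite -[RHS]e eb big_distrl -big_split; apply: eq_bigr => i _ /=.
  by rewrite mulrDl nth_take // -!mulrA [fs`_k * _]mulrC.
move=> i; rewrite ltnS leq_eqVlt => /orP[/eqP->|lti].
  by apply: sub; exists b; rewrite szk.
have /sub h := IH (ltnW ltk) (fun i => c i + b`_i * fs`_k) e' i lti.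
rewrite -[c i](addrK (b`_i * fs`_k)); apply: in_idealB => //.
apply/in_idealMl/in_ideal_mem; rewrite (take_nth 0) // mem_rcons inE eqxx.
by [].
Qed.

End Ideals.

Section MonomialMaps.
Variable R : comNzRingType.

(** The linear map induced by an arbitrary map of exponents. It covers both monomial substitutions,
    where [nu] is additive, and reduction to normal form, where it is not. *)
Definition mlin n k (nu : 'X_{1..n} -> 'X_{1..k}) (p : {mpoly R[n]}) : {mpoly R[k]} :=
  \sum_(m <- msupp p) p@_m *: 'X_[nu m].

Lemma mlinwE n k (nu : 'X_{1..n} -> 'X_{1..k}) p w : (msize p <= w)%N ->
  mlin nu p = \sum_(m : 'X_{1..n < w}) p@_m *: 'X_[nu m].
Proof.
move=> le_pw; set I : subFinType _ := 'X_{1..n < w}.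
rewrite /mlin (big_mksub I) ?msupp_uniq //=; last first.
  by move=> x /msize_mdeg_lt /leq_trans; apply.
by rewrite big_rmcond //= => m /memN_msupp_eq0 ->; rewrite scale0r.
Qed.

Lemma mlin_is_linear n k (nu : 'X_{1..n} -> 'X_{1..k}) : linear (mlin nu).
Proof.
move=> c p q; pose w := maxn (msize (c *: p + q)) (maxn (msize p) (msize q)).
rewrite !(@mlinwE _ _ _ _ w) ?leq_max ?leqnn ?orbT // scaler_sumr -big_split.
by apply: eq_bigr => m _; rewrite /= mcoeffD mcoeffZ scalerDl scalerA.
Qed.

HB.instance Definition _ n k (nu : 'X_{1..n} -> 'X_{1..k}) :=
  GRing.isLinear.Build R {mpoly R[n]} {mpoly R[k]} *:%R (mlin nu) (mlin_is_linear nu).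

Lemma mlinX n k (nu : 'X_{1..n} -> 'X_{1..k}) m : mlin nu 'X_[m] = 'X_[nu m].
Proof. by rewrite /mlin msuppX big_seq1 mcoeffX eqxx scale1r. Qed.

Lemma mlinE n k (nu : 'X_{1..n} -> 'X_{1..k}) (f : {linear {mpoly R[n]} -> {mpoly R[k]}}) p :
  (forall m, f 'X_[m] = 'X_[nu m]) -> f p = mlin nu p.
Proof.
move=> fX; rewrite [p in f p]mpolyE linear_sum; apply: eq_bigr => m _.
by rewrite linearZ fX.
Qed.

Lemma mlin_comp n k l (mu : 'X_{1..k} -> 'X_{1..l}) (nu : 'X_{1..n} -> 'X_{1..k}) p :
  mlin mu (mlin nu p) = mlin (mu \o nu) p.
Proof.
rewrite {2}/mlin linear_sum; apply: eq_bigr => m _.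
by rewrite linearZ /= mlinX.
Qed.

Lemma mlinMX n k (nu : 'X_{1..n} -> 'X_{1..k}) u v p :
  (forall m, nu (m + u)%MM = (nu m + v)%MM) ->
  mlin nu (p * 'X_[u]) = mlin nu p * 'X_[v].
Proof.
move=> H; rewrite [p in LHS]mpolyE mulr_suml linear_sum [mlin nu p]/mlin mulr_suml.
apply: eq_bigr => m _; rewrite -!scalerAl linearZ /= -!mpolyXD mlinX.
by rewrite H.
Qed.

(** No other monomial of the support lands on [nu m0], so nothing else contributes to this
    coefficient. *)
Lemma mcoeff_mlin n k (nu : 'X_{1..n} -> 'X_{1..k}) p m0 :
  (forall m, m \in msupp p -> nu m = nu m0 -> m = m0) ->
  (mlin nu p)@_(nu m0) = p@_m0.
Proof.
move=> H; rewrite /mlin linear_sum /=; have [m0p|m0p] := boolP (m0 \in msupp p).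
  rewrite (bigD1_seq m0) ?msupp_uniq //= mcoeffZ mcoeffX eqxx mulr1.
  rewrite big_seq_cond big1 ?addr0 // => m /andP[mp nm].
  rewrite mcoeffZ mcoeffX; case: eqP => [/(H m mp)/eqP|]; last by rewrite mulr0.
  by rewrite (negPf nm).
rewrite (memN_msupp_eq0 m0p) big_seq_cond big1 // => m /andP[mp _].
rewrite mcoeffZ mcoeffX; case: eqP => [/(H m mp) e|]; last by rewrite mulr0.
by rewrite -e mp in m0p.
Qed.

Lemma mlin_inj n k (nu : 'X_{1..n} -> 'X_{1..k}) p :
  {in msupp p &, injective nu} -> mlin nu p = 0 -> p = 0.
Proof.
move=> inj e; apply/mpolyP => m; rewrite mcoeff0.
have [mp|/memN_msupp_eq0 //] := boolP (m \in msupp p).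
by rewrite -(mcoeff_mlin (nu := nu)) ?e ?mcoeff0 // => m' m'p /inj; apply.
Qed.

Lemma msupp_mlin n k (nu : 'X_{1..n} -> 'X_{1..k}) p m : m \in msupp (mlin nu p) ->
  exists2 m', m' \in msupp p & m = nu m'.
Proof.
rewrite mcoeff_msupp => mp.
have /hasP[m' m'p /eqP e] : has (fun m' => nu m' == m) (msupp p).
  apply: contraNT mp => /hasPn H; rewrite /mlin linear_sum big_seq big1 //= => m' m'p.
  by rewrite mcoeffZ mcoeffX (negPf (H _ m'p)) mulr0.
by exists m'.
Qed.

Lemma comp_mpoly_mlin n k (h : 'I_n -> 'X_{1..k}) (p : {mpoly R[n]}) :
  p \mPo [tuple 'X_[h i] | i < n] = mlin (fun m => \sum_i h i *+ m i)%MM p.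
Proof.
apply: (@mlinE n k _ (comp_mpoly [tuple 'X_[R, h i] | i < n])) => m.
rewrite [LHS]comp_mpolyX -mprodXnE; apply: eq_bigr => i _.
by rewrite tnth_mktuple.
Qed.

End MonomialMaps.

(** * Binomials with disjoint leading terms *)

Section DisjointPairs.
Variables (R : idomainType) (n : nat) (tau : 'I_n * 'I_n -> 'X_{1..n}).
Implicit Types (l : 'I_n * 'I_n) (L : seq ('I_n * 'I_n)) (m : 'X_{1..n}).

Definition pair_mnm l : 'X_{1..n} := (U_(l.1) + U_(l.2))%MM.

Definition pair_poly l : {mpoly R[n]} := 'X_[pair_mnm l] - 'X_[tau l].

(** For [l.1 != l.2], the largest power of the leading monomial of [l] that divides [m]. *)
Definition pair_mult l m := minn (m l.1) (m l.2).

Definition reduce1 l m : 'X_{1..n} :=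
  (m - pair_mnm l *+ pair_mult l m + tau l *+ pair_mult l m)%MM.

(** A single pass suffices for [good] lists: no step creates or destroys variables of the other
    leading monomials. *)
Fixpoint reduce L m := if L is l :: L' then reduce L' (reduce1 l m) else m.

Definition avoids (u : 'X_{1..n}) l := (u l.1 == 0%N) && (u l.2 == 0%N).

Definition good L := [/\ uniq L,
  forall l, l \in L -> l.1 != l.2,
  forall l l', l \in L -> l' \in L -> avoids (tau l) l'
  & forall l l', l \in L -> l' \in L -> l != l' -> avoids (pair_mnm l) l'].

Lemma good_cons l L : good (l :: L) -> good L.
Proof.
move=> [/andP[_ u] d t p]; split=> // [l' l'L|l' l'' l'L l''L|l' l'' l'L l''L];
  by [apply: d; rewrite inE l'L orbT
     | apply: t; rewrite inE ?l'L ?l''L orbT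
     | apply: p; rewrite inE ?l'L ?l''L orbT].
Qed.

Lemma pair_mnm1 l : l.1 != l.2 -> (pair_mnm l l.1 = 1%N) * (pair_mnm l l.2 = 1%N).
Proof.
by move=> d; rewrite /pair_mnm !mnmDE !mnm1E !eqxx eq_sym (negPf d).
Qed.

Lemma pair_mnm0 l i : i != l.1 -> i != l.2 -> pair_mnm l i = 0%N.
Proof.
by move=> d1 d2; rewrite mnmDE !mnm1E ![_ == i]eq_sym (negPf d1) (negPf d2).
Qed.

Lemma pair_mult_le l m : l.1 != l.2 -> (pair_mnm l *+ pair_mult l m <= m)%MM.
Proof.
move=> d; apply/mnm_lepP => i; rewrite mulmnE.
have [->|i1] := eqVneq i l.1; first by rewrite pair_mnm1 // mul1n geq_minl.
have [->|i2] := eqVneq i l.2; first by rewrite pair_mnm1 // mul1n geq_minr.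
by rewrite pair_mnm0.
Qed.

Lemma pair_multD l m u : avoids u l -> pair_mult l (m + u)%MM = pair_mult l m.
Proof. by case/andP=> /eqP u1 /eqP u2; rewrite /pair_mult !mnmDE u1 u2 !addn0. Qed.

Lemma addmAC (a b c : 'X_{1..n}) : (a + b + c = a + c + b)%MM.
Proof. by rewrite -!addmA [(b + c)%MM]addmC. Qed.

Lemma reduce1D l m u : l.1 != l.2 -> avoids u l ->
  reduce1 l (m + u) = (reduce1 l m + u)%MM.
Proof.
move=> d au; rewrite /reduce1 pair_multD // [in RHS]addmAC.
congr (_ + _)%MM; rewrite [(m + u)%MM]addmC -addmBA; first by rewrite addmC.
exact: pair_mult_le.
Qed.

(** The extra leading monomial raises the multiplicity by one and is traded for one more tail. This
    is why [reduce1 l] kills the multiples of [pair_poly l]. *)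
Lemma reduce1_pair l m : l.1 != l.2 -> avoids (tau l) l ->
  reduce1 l (m + pair_mnm l) = reduce1 l (m + tau l).
Proof.
move=> d at_; rewrite [RHS]reduce1D // /reduce1.
have -> : pair_mult l (m + pair_mnm l)%MM = (pair_mult l m).+1.
  by rewrite /pair_mult (mnmDE l.1 m) (mnmDE l.2 m) !(pair_mnm1 d) !addn1 minnSS.
rewrite [(tau l *+ _.+1)%MM]mulmSr addmA [(pair_mnm l *+ _.+1)%MM]mulmS.
by rewrite -submDA addmK.
Qed.

Definition nf L : {mpoly R[n]} -> {mpoly R[n]} := mlin (reduce L).

Lemma nf_cons l L p : nf (l :: L) p = nf L (mlin (reduce1 l) p).
Proof. by rewrite /nf mlin_comp. Qed.

Lemma nf_nil p : nf [::] p = p.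
Proof. by rewrite /nf [RHS]mpolyE. Qed.

Lemma mlin1_pair l l' p : l.1 != l.2 -> avoids (pair_mnm l') l ->
  avoids (tau l') l -> mlin (reduce1 l) (p * pair_poly l') = mlin (reduce1 l) p * pair_poly l'.
Proof.
move=> d a1 a2; rewrite /pair_poly !mulrBr linearB /=.
by rewrite !(@mlinMX _ _ _ (reduce1 l) _ _ _ (fun m => reduce1D m d _)).
Qed.

Lemma mlin1_self l p : l.1 != l.2 -> avoids (tau l) l ->
  mlin (reduce1 l) (p * pair_poly l) = 0.
Proof.
move=> d at_; rewrite [p]mpolyE mulr_suml linear_sum big1 // => m _ /=.
rewrite -scalerAl linearZ /= /pair_poly mulrBr linearB /= -!mpolyXD !mlinX.
by rewrite reduce1_pair // subrr scaler0.
Qed.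

(** On a monomial the difference is a multiple of the difference of [k]-th powers of leading
    monomial and tail, hence of [pair_poly l]. *)
Lemma sub_mlin1 l p : l.1 != l.2 -> exists q, p - mlin (reduce1 l) p = q * pair_poly l.
Proof.
move=> d; elim/mpolyind: p => [|c m p _ _ [q eq]].
  by exists 0; rewrite linear0 subrr mul0r.
suff [q' eq'] : exists q', 'X_[m] - mlin (reduce1 l) 'X_[m] = q' * pair_poly l :> {mpoly R[n]}.
  exists (c *: q' + q); rewrite linearP /= opprD addrACA -scalerBr eq eq'.
  by rewrite mulrDl scalerAl.
rewrite mlinX /reduce1; set k := pair_mult l m.
rewrite -{1}(submK (pair_mult_le m d)) -/k !mpolyXD -mulrBr -!mpolyXn subrXX.
by rewrite -/(pair_poly l) [pair_poly l * _]mulrC mulrA; eexists.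
Qed.

(** Telescoping over the successive reductions. Together with [nf_ideal] this makes the ideal of the
    binomials the kernel of [nf L]. *)
Lemma sub_nf L p : good L -> in_ideal _ (map pair_poly L) (p - nf L p).
Proof.
elim: L p => [|l L IH] p gL; first by rewrite nf_nil subrr; apply: in_ideal0.
have [_ d _ _] := gL.
rewrite nf_cons -(subrKA (mlin (reduce1 l) p)); apply: in_idealD.
  have [q ->] := sub_mlin1 p (d l (mem_head _ _)).
  by apply/in_idealMl/in_ideal_mem; rewrite /= inE eqxx.
apply: in_ideal_incl (IH _ (good_cons gL)) => f fL.
by apply: in_ideal_mem; rewrite /= inE fL orbT.
Qed.

(** Both terms of [pair_poly l] avoid the leading variables of [L], so they pass through every
    reduction unchanged. *)
Lemma nf_mulr L l p : good (l :: L) -> nf L (p * pair_poly l) = nf L p * pair_poly l.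
Proof.
elim: L p => [|l' L IH] p gL; first by rewrite !nf_nil.
have [/andP[lL _] d t a] := gL.
have l'L : l' \in l :: l' :: L by rewrite !inE eqxx orbT.
have nl : l != l' by apply: contraNneq lL => ->; rewrite inE eqxx.
rewrite !nf_cons mlin1_pair ?IH //; first last.
- by apply: t; rewrite ?mem_head.
- by apply: a; rewrite ?mem_head.
- exact: d.
have s x : x \in l :: L -> x \in l :: l' :: L.
  by rewrite !inE => /orP[->|->]; rewrite ?orbT.
move: lL; rewrite inE negb_or => /andP[_ lL].
case: gL => /= /andP[_ /andP[_ uL]] _ _ _; split; first by rewrite /= lL.
- by move=> x /s; apply: d.
- by move=> x y /s xL /s; apply: t.
- by move=> x y /s xL /s; apply: a.
Qed.

Lemma nf_ideal L p : good L -> in_ideal _ (map pair_poly L) p -> nf L p = 0.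
Proof.
elim: L p => [|l L IH] p gL.
  by case=> c ->; rewrite big_ord0 nf_nil.
have [/andP[lL _] d t a] := gL; have l0 := mem_head l L.
case/in_ideal_cons=> c [q [-> qI]]; rewrite nf_cons linearD /= mlin1_self ?add0r; first last.
- exact: t.
- exact: d.
apply: IH; first exact: good_cons gL.
case/in_idealP: qI => b ->; rewrite linear_sum; apply: in_ideal_sum => i _ /=.
have lti : (i < size L)%N by rewrite -(size_map pair_poly L); exact: ltn_ord.
rewrite (nth_map l) //; set l' := nth l L i.
have l'L : l' \in L by apply: mem_nth.
have l'l : l' \in l :: L by rewrite inE l'L orbT.
rewrite mlin1_pair; first last.
- exact: t.
- by apply: a => //; apply: contraNneq lL => <-.
- exact: d.
by apply/in_idealMl/in_ideal_mem/map_f.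
Qed.

Lemma pair_poly_neq0 l : l.1 != l.2 -> avoids (tau l) l -> pair_poly l != 0.
Proof.
move=> d /andP[/eqP t1 _]; rewrite subr_eq0; apply/eqP => /mpolyP/(_ (pair_mnm l)).
rewrite !mcoeffX eqxx; case: eqP => [e|_ /eqP]; last by rewrite oner_eq0.
by have := pair_mnm1 d; rewrite -e t1 => -[].
Qed.

Lemma good_take L k : good L -> good (take k L).
Proof.
move=> [u d t a].
split=> [|x /mem_take|x y /mem_take xL /mem_take yL|x y /mem_take xL /mem_take yL];
  [exact: take_uniq | exact: d | exact: t | exact: a].
Qed.

Lemma good_rot L l : good (rcons L l) -> good (l :: L).
Proof.
have e : rcons L l =i l :: L by move=> x; rewrite mem_rcons.
move=> [u d t a]; split=> [|x|x y|x y]; rewrite -?e; [|exact: d|exact: t|exact: a].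
by rewrite /= -rcons_uniq.
Qed.

Lemma nf1 L : good L -> nf L 1 = 1.
Proof.
rewrite /nf -mpolyX0 mlinX; elim: L => [|l L IH] //= gL.
suff -> : reduce1 l 0%MM = 0%MM by apply: IH; apply: good_cons gL.
by rewrite /reduce1 /pair_mult mnm0E min0n !mulm0n subm0 addm0.
Qed.

(** If [g * pair_poly l] lies in the ideal of the earlier binomials, then [nf g * pair_poly l = 0];
    in a domain this gives [nf g = 0], so [g] is in that ideal. *)
Lemma good_regular L : good L -> regular_seq _ (map pair_poly L).
Proof.
move=> gL; split; last by move/(nf_ideal gL); rewrite nf1 //; apply/eqP/oner_neq0.
move=> i; rewrite size_map => lti g; rewrite -map_take.
have [l0 _] : {l0 | l0 \in L} by case: (L) lti => // l0 L' _; exists l0; rewrite mem_head.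
rewrite (nth_map l0) //; set l := nth l0 L i => gI.
(* Goodness is independent of the order, so [l] can be moved in front, as [nf_mulr] expects. *)
have gT : good (rcons (take i L) l) by rewrite -take_nth //; apply: good_take.
have gl := good_rot gT; have gi := good_cons gl.
have := nf_ideal gi gI; rewrite nf_mulr // => /eqP; rewrite mulf_eq0.
have [_ d t _] := gl; have ll := mem_head l (take i L).
rewrite (negPf (pair_poly_neq0 (d _ ll) (t _ _ ll ll))) orbF => /eqP e.
by have := sub_nf g gi; rewrite e subr0.
Qed.

Lemma pair_mult_reduce L l m :
  (forall l', l' \in L -> avoids (pair_mnm l') l && avoids (tau l') l) ->
  pair_mult l (reduce L m) = pair_mult l m.
Proof.
elim: L m => [|l' L IH] m //= H; rewrite IH => [|x xL]; last first.
  by apply: H; rewrite inE xL orbT.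
have /andP[/andP[/eqP a1 /eqP a2] /andP[/eqP t1 /eqP t2]] := H l' (mem_head _ _).
rewrite /pair_mult /reduce1 !mnmDE !mnmBE !mulmnE a1 a2 t1 t2 !mul0n.
by rewrite !subn0 !addn0.
Qed.

(** The step for [l] removes one of its two variables completely, and the later steps touch neither
    of them. *)
Lemma reduce_pair_mult L l m : good L -> l \in L -> pair_mult l (reduce L m) = 0%N.
Proof.
elim: L m => [|l' L IH] m gL //=; rewrite inE => /orP[/eqP el|]; last first.
  by apply: IH; apply: good_cons gL.
move: gL; rewrite -{l'}el => gL; have [/andP[lL _] d t a] := gL.
have l0 := mem_head l L; rewrite pair_mult_reduce => [|x xL]; last first.
  have xl : x \in l :: L by rewrite inE xL orbT.
  by rewrite t // a //; apply: contraNneq lL => <-.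
have /andP[/eqP t1 /eqP t2] := t _ _ l0 l0.
rewrite {1}/pair_mult /reduce1 !mnmDE !mnmBE !mulmnE t1 t2 !mul0n !addn0.
by rewrite !pair_mnm1 ?d // !mul1n /pair_mult -subn_minl subnn.
Qed.

End DisjointPairs.

(** * The toric ideal of a poset *)

Section Toric.
Variables (T : finType) (le : rel T) (K : fieldType).
Hypothesis posT : is_poset T le.
Local Notation N := (nvars T le).
Implicit Types (m : 'X_{1..N}) (J : {set T}) (i j : 'I_N) (l : 'I_N * 'I_N).

Definition idl i : {set T} := enum_val (A := conn_ideals T le) i.

Lemma idl_indec i : indec le (idl i).
Proof. by apply/(conn_idealP posT); have := enum_valP i; rewrite inE. Qed.

Lemma idl_inj : injective idl. Proof. exact: enum_val_inj. Qed.

Lemma idl_ex J : indec le J -> exists i, idl i = J.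
Proof.
move=> /(conn_idealP posT) cJ; have JJ : J \in conn_ideals T le by rewrite inE.
by exists (enum_rank_in JJ J); apply: enum_rankK_in.
Qed.

(* [0] when [J] is not a connected order ideal. *)
Definition umon J : 'X_{1..N} := [multinom (idl i == J : nat) | i < N].

Lemma umonE J i : umon J i = (idl i == J). Proof. exact: mnmE. Qed.

Lemma umon_idl i : umon (idl i) = U_(i)%MM.
Proof. by apply/mnmP => j; rewrite umonE mnm1E (inj_eq idl_inj) eq_sym. Qed.

Definition chi J : 'X_{1..#|T|} := (\sum_(x in J) U_(enum_rank x))%MM.

Lemma chiE J x : chi J (enum_rank x) = (x \in J).
Proof.
rewrite mnm_sumE; have [xJ|xJ] := boolP (x \in J).
  rewrite (bigD1 x) //= mnm1E eqxx big1 // => y /andP[_ nyx].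
  by rewrite mnm1E (inj_eq enum_rank_inj) (negPf nyx).
rewrite big1 // => y yJ; rewrite mnm1E (inj_eq enum_rank_inj).
by case: eqP xJ => // <-; rewrite yJ.
Qed.

Definition deg m : 'X_{1..#|T|} := (\sum_i chi (idl i) *+ m i)%MM.

Lemma degE m x : deg m (enum_rank x) = (\sum_i (x \in idl i) * m i)%N.
Proof. by rewrite mnm_sumE; apply: eq_bigr => i _; rewrite mulmnE chiE. Qed.

Lemma mnm_rankP (u v : 'X_{1..#|T|}) :
  (forall x, u (enum_rank x) = v (enum_rank x)) -> u = v.
Proof. by move=> e; apply/mnmP => k; rewrite -(enum_valK k). Qed.

Lemma deg0 : deg 0%MM = 0%MM.
Proof. by rewrite /deg big1 // => i _; rewrite mnm0E mulm0n. Qed.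

Lemma degD m m' : deg (m + m')%MM = (deg m + deg m')%MM.
Proof.
apply: mnm_rankP => x; rewrite mnmDE !degE -big_split; apply: eq_bigr => i _.
by rewrite mnmDE mulnDr.
Qed.

Lemma degU i : deg U_(i)%MM = chi (idl i).
Proof.
apply: mnm_rankP => x; rewrite degE chiE (bigD1 i) //= mnm1E eqxx muln1.
by rewrite big1 ?addn0 // => j nj; rewrite mnm1E eq_sym (negPf nj) muln0.
Qed.

Lemma deg_umon J : indec le J -> deg (umon J) = chi J.
Proof. by case/idl_ex=> i <-; rewrite umon_idl degU. Qed.

Lemma deg_sum (I : Type) (r : seq I) (P : pred I) (F : I -> 'X_{1..N}) :
  deg (\sum_(a <- r | P a) F a)%MM = (\sum_(a <- r | P a) deg (F a))%MM.
Proof. exact: (big_morph deg degD deg0). Qed.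

Lemma phiP_mlin (p : {mpoly K[N]}) : phiP K T le p = mlin deg p.
Proof.
rewrite -comp_mpoly_mlin /phiP; congr (_ \mPo _); apply: eq_mktuple => i.
by rewrite /t_monomial mprodXE.
Qed.

Lemma phiPX m : phiP K T le 'X_[m] = 'X_[deg m].
Proof. by rewrite phiP_mlin mlinX. Qed.

Lemma phiPB p q : phiP K T le (p - q) = phiP K T le p - phiP K T le q.
Proof. exact: rmorphB. Qed.

Lemma phiPM p q : phiP K T le (p * q) = phiP K T le p * phiP K T le q.
Proof. exact: rmorphM. Qed.

Lemma in_IP_ideal fs p : (forall f, f \in fs -> in_IP K T le f) ->
  in_ideal _ fs p -> in_IP K T le p.
Proof.
move=> fI /in_idealP[c ->]; rewrite /in_IP /phiP rmorph_sum big1 // => i _.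
rewrite rmorphM /= -/(phiP K T le (fs`_i)) (fI fs`_i) ?mulr0 //.
exact: mem_nth.
Qed.

(** * Standard monomials *)

Definition standard m := forall i j, (0 < m i)%N -> (0 < m j)%N ->
  ~~ crossing (idl i) (idl j).

Lemma deg_gt0P m x :
  reflect (exists2 i, (0 < m i)%N & x \in idl i) (0 < deg m (enum_rank x))%N.
Proof.
rewrite degE lt0n sum_nat_eq0 negb_forall; apply: (iffP existsP) => -[i].
  by rewrite muln_eq0 negb_or eqb0 negbK -lt0n => /andP[xi mi]; exists i.
by move=> mi xi; exists i; rewrite muln_eq0 negb_or eqb0 negbK xi -lt0n.
Qed.

(** Fix [x] in [idl i] and take the largest ideal [idl j] of [m'] through [x]. If it did not contain
    the connected [idl i], some [u] in it would lie below a [v] of [idl i] outside it; an ideal of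
    [m'] through [v] also contains [u], so it would be comparable to [idl j] and strictly larger.
    Maximality of [idl i] then gives equality. *)
Lemma standard_max_common m m' i : standard m' -> deg m = deg m' -> (0 < m i)%N ->
  (forall j, (0 < m' j)%N -> (#|idl j| <= #|idl i|)%N) -> (0 < m' i)%N.
Proof.
move=> st e mi mx; have cov x : x \in idl i -> exists2 j, (0 < m' j)%N & x \in idl j.
  by move=> xi; apply/deg_gt0P; rewrite -e; apply/deg_gt0P; exists i.
have /set0Pn[x xi] := indec_neq0 (idl_indec i); have [j0 mj0 xj0] := cov x xi.
pose P j := (0 < m' j)%N && (x \in idl j).
have Pj0 : P j0 by rewrite /P mj0.
case: (arg_maxnP (fun j => #|idl j|) Pj0) => j /andP[mj xj] jmax.
have sij : idl i \subset idl j.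
  apply: (indec_sub (idl_indec i) (indec_ideal (idl_indec j))); last first.
    by apply/set0Pn; exists x; rewrite inE xi.
  apply/idealP => u v uv; rewrite !inE => /andP[vj vi].
  rewrite (idealP _ _ (indec_ideal (idl_indec i)) _ _ uv vi) andbT.
  apply/negP => uj; have [k mk vk] := cov v vi.
  have uk := idealP _ _ (indec_ideal (idl_indec k)) _ _ uv vk.
  have [sjk|skj] := orP (not_crossing uj uk (st j k mj mk)); last first.
    by rewrite (subsetP skj _ vk) in vj.
  have /jmax h : P k by rewrite /P mk (subsetP sjk).
  have /eqP ejk : idl j == idl k by rewrite eqEcard sjk.
  by rewrite ejk vk in vj.
have /eqP/idl_inj -> // : idl i == idl j by rewrite eqEcard sij mx.
Qed.

Lemma standard_sub m m' : standard (m + m')%MM -> standard m.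
Proof.
by move=> st i j mi mj; apply: st; rewrite mnmDE; apply: ltn_addr.
Qed.

Lemma deg_eq0 m : deg m = 0%MM -> m = 0%MM.
Proof.
move=> e; apply/mnmP => i; rewrite mnm0E; apply/eqP; rewrite -leqn0 leqNgt; apply/negP => mi.
have /set0Pn[x xi] := indec_neq0 (idl_indec i).
have : (0 < deg m (enum_rank x))%N by apply/deg_gt0P; exists i.
by rewrite e mnm0E.
Qed.

(** A largest ideal occurring in either monomial occurs in both; cancel it and induct on the total
    degree. *)
Lemma deg_inj_standard m m' : standard m -> standard m' -> deg m = deg m' -> m = m'.
Proof.
have [n] := ubnP (mdeg m); elim: n m m' => // n IH m m'; rewrite ltnS => Hn st st' e.
have [e0|m0] := eqVneq m 0%MM; first by rewrite e0 deg0 in e; rewrite e0 (deg_eq0 (esym e)).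
pose P i := (0 < m i)%N || (0 < m' i)%N.
have [i0 Pi0] : exists i, P i.
  apply/existsP; apply: contraNT m0; rewrite negb_exists => /forallP H.
  apply/eqP/mnmP => i; rewrite mnm0E; apply/eqP; have := H i.
  by rewrite negb_or -!eqn0Ngt => /andP[].
case: (arg_maxnP (fun j => #|idl j|) Pi0) => i Pi imax.
have mi : (0 < m i)%N.
  case/orP: Pi => // mi; apply: (standard_max_common st (esym e) mi) => j mj.
  by apply: imax; rewrite /P mj.
have mi' : (0 < m' i)%N.
  by apply: (standard_max_common st' e mi) => j mj; apply: imax; rewrite /P mj orbT.
have dec (k : 'X_{1..N}) : (0 < k i)%N -> (k - U_(i) + U_(i) = k)%MM.
  by move=> ki; rewrite submK // lep1mP -lt0n.
rewrite -(dec m mi) -(dec m' mi') in Hn st st' e *.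
congr (_ + _)%MM; apply: IH.
- by rewrite mdegD mdeg1 addn1 in Hn.
- exact: standard_sub st.
- exact: standard_sub st'.
- by apply: (@addIm _ (deg U_(i)%MM)); rewrite -!degD.
Qed.

(** * The binomials of the crossing pairs *)

(** The condition [l.1 < l.2] lists each unordered pair once. *)
Definition cross_pairs : seq ('I_N * 'I_N) :=
  [seq l : 'I_N * 'I_N <- enum {: 'I_N * 'I_N} | (l.1 < l.2)%N && crossing (idl l.1) (idl l.2)].

Lemma mem_cross_pairs l :
  (l \in cross_pairs) = (l.1 < l.2)%N && crossing (idl l.1) (idl l.2).
Proof. by rewrite mem_filter mem_enum andbT. Qed.

Definition tail (l : 'I_N * 'I_N) : 'X_{1..N} :=
  (umon (idl l.1 :|: idl l.2)
   + \sum_(C in components le (idl l.1 :&: idl l.2)) umon C)%MM.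

(** Inclusion-exclusion for the indicators of the two ideals, the components summing to the
    indicator of the intersection. *)
Lemma deg_tail l : crossing (idl l.1) (idl l.2) -> deg (tail l) = deg (pair_mnm l).
Proof.
move=> xl; have c1 := idl_indec l.1; have c2 := idl_indec l.2.
rewrite /tail /pair_mnm !degD !degU deg_umon; last exact: indecU (crossing_meet xl).
rewrite deg_sum (eq_bigr chi); last first.
  by move=> C /(component_indec posT)/deg_umon.
apply: mnm_rankP => x; rewrite !mnmDE mnm_sumE !chiE.
under eq_bigr do rewrite chiE.
rewrite sum_components //; last by apply: idealI; apply: indec_ideal.
by rewrite !inE; do 2!case: (x \in _).
Qed.

Lemma in_IP_pair_poly l : l \in cross_pairs -> in_IP K T le (pair_poly K tail l).
Proof.
rewrite mem_cross_pairs => /andP[_ xl].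
by rewrite /in_IP /pair_poly phiPB !phiPX deg_tail // subrr.
Qed.

Hypothesis mT : matched le.

(** By [matched_union] and [matched_component], the ideals occurring in a tail cross nothing. *)
Lemma tail_eq0 l i j : l \in cross_pairs -> crossing (idl i) (idl j) -> tail l i = 0%N.
Proof.
rewrite mem_cross_pairs => /andP[_ xl] xi.
have c1 := idl_indec l.1; have c2 := idl_indec l.2; have cj := idl_indec j.
rewrite mnmDE mnm_sumE umonE.
have -> : (idl i == idl l.1 :|: idl l.2) = false.
  by apply: contraTF xi => /eqP ->; exact: (matched_union mT c1 c2 cj xl).
rewrite big1 // => C kC; rewrite umonE.
have -> // : (idl i == C) = false.
apply: contraTF xi => /eqP ->; exact: (matched_component posT mT c1 c2 cj xl kC).
Qed.

(** Tails avoid leading variables by [tail_eq0], and distinct crossing pairs share no ideal because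
    each ideal has at most one partner. *)
Lemma cross_pairs_good : good tail cross_pairs.
Proof.
split=> [|l|l l' lL l'L|l l' lL l'L nll].
- by rewrite filter_uniq // enum_uniq.
- by rewrite mem_cross_pairs => /andP[/ltn_eqF/negbT].
- have := l'L; rewrite mem_cross_pairs => /andP[_ xl].
  rewrite /avoids (tail_eq0 lL xl) /=.
  by rewrite crossingC in xl; rewrite (tail_eq0 lL xl).
have := lL; have := l'L; rewrite !mem_cross_pairs => /andP[lt' xl'] /andP[lt xl].
have xlC := xl; rewrite crossingC in xlC; have xlC' := xl'; rewrite crossingC in xlC'.
have uq a b c : crossing (idl a) (idl b) -> crossing (idl a) (idl c) -> b = c.
  by move=> xb xc; apply/idl_inj; apply: mT xb xc; apply: idl_indec.
(* It suffices to treat one end [a] of [l'], with [b] the other end. *)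
suff d a b : (a = l'.1 /\ b = l'.2) \/ (a = l'.2 /\ b = l'.1) -> a != l.1 /\ a != l.2.
  have [|n1 n2] := d l'.1 l'.2; first by left.
  have [|n3 n4] := d l'.2 l'.1; first by right.
  by rewrite /avoids !pair_mnm0.
move=> ab; have xab : crossing (idl a) (idl b) by case: ab => -[-> ->].
split; apply/eqP => ea; rewrite ea in xab.
  have eb := uq _ _ _ xab xl; case: ab => -[a1 b1]; last first.
    by move: lt lt'; rewrite -ea -eb a1 b1 => /ltnW; rewrite leqNgt => /negPf->.
  case/negP: nll; apply/eqP; rewrite (surjective_pairing l) (surjective_pairing l').
  by rewrite -ea -eb a1 b1.
have eb := uq _ _ _ xab xlC; case: ab => -[a1 b1].
  by move: lt lt'; rewrite -ea -eb a1 b1 => /ltnW; rewrite leqNgt => /negPf->.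
case/negP: nll; apply/eqP; rewrite (surjective_pairing l) (surjective_pairing l').
by rewrite -ea -eb a1 b1.
Qed.

Lemma reduce_standard m : standard (reduce tail cross_pairs m).
Proof.
have half i j : (i < j)%N -> (0 < reduce tail cross_pairs m i)%N ->
    (0 < reduce tail cross_pairs m j)%N -> ~~ crossing (idl i) (idl j).
  move=> ij mi mj; apply/negP => xij.
  have /(reduce_pair_mult m cross_pairs_good) : (i, j) \in cross_pairs.
    by rewrite mem_cross_pairs ij.
  by move/eqP; rewrite /pair_mult /= -leqn0 geq_min !leqn0 !eqn0Ngt mi mj.
move=> i j mi mj; case: (ltngtP i j) => [ij|ji|/val_inj ->].
- exact: half.
- by rewrite crossingC; apply: half.
- by apply/negP => /crossingNl; rewrite subxx.
Qed.

(** The normal form of an element of the toric ideal stays in it and involves only standard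
    monomials. These have distinct degrees, so it vanishes. *)
Lemma in_IP_cross_pairs p :
  in_IP K T le p <-> in_ideal _ (map (pair_poly K tail) cross_pairs) p.
Proof.
have gL := cross_pairs_good.
have sub q : in_ideal _ (map (pair_poly K tail) cross_pairs) q -> in_IP K T le q.
  by apply: in_IP_ideal => f /mapP[l lL ->]; apply: in_IP_pair_poly.
split=> [pI|/sub //]; have pn := sub_nf p gL.
suff n0 : nf tail cross_pairs p = 0 by rewrite n0 subr0 in pn.
have : in_IP K T le (nf tail cross_pairs p).
  rewrite -[nf _ _ _](subKr p) /in_IP phiPB pI.
  by move: (sub _ pn); rewrite /in_IP => ->; rewrite subr0.
rewrite /in_IP phiP_mlin; apply: mlin_inj => m1 m2.
rewrite /nf => /msupp_mlin[m1' _ ->] /msupp_mlin[m2' _ ->].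
by apply: deg_inj_standard; apply: reduce_standard.
Qed.

Lemma matched_complete_intersection :
  complete_intersection (Sring K T le) (in_IP K T le).
Proof.
exists (map (pair_poly K tail) cross_pairs); split; last exact: in_IP_cross_pairs.
exact: good_regular cross_pairs_good.
Qed.

End Toric.

(** * Complete intersections have few crossings *)

(** Over the fraction field the product is invertible, hence of rank [r], and it factors through
    dimension [s]. *)
Lemma leq_of_mulmx_diag (R : idomainType) r s (C : 'M[R]_(r, s)) (D : 'M[R]_(s, r))
  (d : 'rV[R]_r) : C *m D = diag_mx d -> (forall i, d 0 i != 0) -> (r <= s)%N.
Proof.
move=> /(congr1 (map_mx (tofrac (R := R)))); rewrite map_mxM map_diag_mx /= => e d0.
have u : diag_mx (map_mx (tofrac (R := R)) d) \in unitmx.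
  rewrite unitmxE det_diag unitfE; apply/prodf_neq0 => i _.
  by rewrite mxE tofrac_eq0.
have /eqP := mxrank_unit u; rewrite -e => /eqP <-.
exact: leq_trans (mxrankM_maxl _ _) (rank_leq_col _).
Qed.

Lemma mcoeff_mul_order2 n (R : comNzRingType) (c f : {mpoly R[n]}) m :
  (forall m', (mdeg m' <= 1)%N -> f@_m' = 0) -> mdeg m = 2%N ->
  (c * f)@_m = c@_0%MM * f@_m.
Proof.
move=> f0 dm; rewrite mcoeffM.
have lt0 : (mdeg (0%MM : 'X_{1..n}) < (mdeg m).+1)%N by rewrite mdeg0.
have ltm : (mdeg m < (mdeg m).+1)%N by [].
rewrite (bigD1 (BMultinom lt0, BMultinom ltm)) /= ?add0m //.
rewrite big1 ?addr0 // => -[[k1 h1] [k2 h2]] /= /andP[/eqP e nk].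
have [k0|k0] := eqVneq k1 0%MM.
  case/negP: nk; rewrite -pair_eqE /pair_eq /= -!val_eqE /= k0.
  by rewrite e k0 add0m !eqxx.
rewrite [f@_k2]f0 ?mulr0 //; have := congr1 mdeg e; rewrite mdegD dm.
by move: k0; rewrite -mdeg_eq0; case: (mdeg k1) => // d _; rewrite addSn => -[->]; rewrite leq_addl.
Qed.

Section Converse.
Variables (T : finType) (le : rel T) (K : fieldType).
Hypothesis posT : is_poset T le.
Local Notation N := (nvars T le).
Local Notation idl := (@idl T le).
Local Notation deg := (@deg T le).
Local Notation phi := (phiP K T le).
Local Notation S := {mpoly K[N]}.
Local Notation KT := {mpoly K[#|T|]}.
Local Notation L := (cross_pairs le).

Let le_refl : reflexive le. Proof. by case: posT. Qed.

(** All coordinates of the degree are at most 1, so ideals occurring in [m] are disjoint subsets of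
    [idl i]; they cover it, and connectedness leaves only one. *)
Lemma deg_eqU (m : 'X_{1..N}) i : deg m = deg U_(i)%MM -> m = U_(i)%MM.
Proof.
move=> e; have dm x : deg m (enum_rank x) = (x \in idl i) by rewrite e degU chiE.
have /set0Pn[x xi] := indec_neq0 (idl_indec posT i).
have [j mj xj] : exists2 j, (0 < m j)%N & x \in idl j by apply/deg_gt0P; rewrite dm xi.
have sji : idl j \subset idl i.
  apply/subsetP => u uj; have : (0 < deg m (enum_rank u))%N by apply/deg_gt0P; exists j.
  by rewrite dm lt0b.
have sij : idl i \subset idl j.
  apply: (indec_sub (idl_indec posT i) (indec_ideal (idl_indec posT j))); last first.
    by apply/set0Pn; exists x; rewrite inE xi.
  apply/idealP => u v uv; rewrite !inE => /andP[vj vi].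
  rewrite (idealP _ _ (indec_ideal (idl_indec posT i)) _ _ uv vi) andbT.
  apply/negP => uj.
  have [k mk vk] : exists2 k, (0 < m k)%N & v \in idl k by apply/deg_gt0P; rewrite dm vi.
  have uk := idealP _ _ (indec_ideal (idl_indec posT k)) _ _ uv vk.
  have nkj : k != j by apply: contraNneq vj => <-.
  have : (deg m (enum_rank u) <= 1)%N by rewrite dm leq_b1.
  rewrite degE (bigD1 j) //= (bigD1 k) //= uj uk !mul1n addnA leqNgt => /negP[].
  apply: leq_trans (leq_addr _ _).
  by case: (m j) mj => // a _; case: (m k) mk => // b _; rewrite addnS.
have /eqP/idl_inj ij : idl i == idl j by rewrite eqEsubset sij.
rewrite -{j}ij in mj xj sji sij.
have em : (m - U_(i) + U_(i) = m)%MM by rewrite submK // lep1mP -lt0n.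
rewrite -em; suff -> : (m - U_(i) = 0)%MM by rewrite add0m.
apply: (deg_eq0 posT); apply: (@addIm _ (deg U_(i)%MM)).
by rewrite -degD em e add0m.
Qed.

(** A monomial of total degree at most 1 is alone in its fibre of [deg], so its coefficient cannot
    cancel. *)
Lemma in_IP_order2 (f : S) (m : 'X_{1..N}) : in_IP K T le f -> (mdeg m <= 1)%N -> f@_m = 0.
Proof.
rewrite /in_IP phiP_mlin => f0 dm.
rewrite -(mcoeff_mlin (nu := deg)) ?f0 ?mcoeff0 // => m' _.
move: dm; rewrite leq_eqVlt ltnS leqn0 mdeg_eq0 => /orP[/mdeg1P[i /eqP->]|/eqP->].
  exact: deg_eqU.
by rewrite deg0; apply: deg_eq0.
Qed.

Lemma pair_mnm_inj : {in L &, injective (@pair_mnm N)}.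
Proof.
move=> l l'; rewrite !mem_cross_pairs => /andP[lt _] /andP[lt' _] e.
have h i : (i == l.1) || (i == l.2) -> (i == l'.1) || (i == l'.2).
  move=> il; apply: contraT; rewrite negb_or => /andP[n1 n2].
  have := pair_mnm0 n1 n2; rewrite -e mnmDE !mnm1E ![_ == i]eq_sym.
  by case/orP: il => ->; rewrite // addn1.
have := h l.1; have := h l.2; rewrite !eqxx orbT => /(_ isT) h2 /(_ isT) h1.
rewrite (surjective_pairing l) (surjective_pairing l').
case/orP: h1 => /eqP e1; case/orP: h2 => /eqP e2; rewrite e1 e2 //.
- by rewrite e1 e2 ltnn in lt.
- by rewrite e1 e2 ltnNge (ltnW lt') in lt.
- by rewrite e1 e2 ltnn in lt.
Qed.

(** If a tail were a product of two crossing variables, one would be the union of [l] and the other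
    a component of the intersection, which is contained in that union. *)
Lemma tail_neq_pair l l' : l \in L -> l' \in L -> tail l != pair_mnm l'.
Proof.
rewrite !mem_cross_pairs => /andP[_ xl] /andP[/ltn_eqF/negbT nl' xl'].
have c1 := idl_indec posT l.1; have c2 := idl_indec posT l.2.
have [k ek] := idl_ex posT (indecU c1 c2 (crossing_meet xl)).
apply/eqP => e.
have key i j : i != j -> crossing (idl i) (idl j) -> i = k -> pair_mnm l' j != 0%N -> False.
  move=> nij xij eik; rewrite -e mnmDE umonE -ek -eik (inj_eq (@idl_inj _ _)) [j == i]eq_sym.
  rewrite (negPf nij) add0n mnm_sumE => h.
  have /existsP[C] : [exists C in components le (idl l.1 :&: idl l.2), umon le C j != 0%N].
    apply: contraNT h; rewrite negb_exists => /forallP H; apply/eqP.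
    by apply: big1 => C kC; apply/eqP; have := H C; rewrite kC negbK.
  rewrite umonE eqb0 negbK => /andP[kC /eqP eC].
  case/negP: (crossingNr xij); rewrite eC eik ek.
  apply: subset_trans (component_sub posT kC) _.
  exact: subset_trans (subsetIl _ _) (subsetUl _ _).
have : pair_mnm l' k != 0%N.
  by rewrite -e mnmDE umonE ek eqxx.
have [p1 p2] := pair_mnm1 nl'.
have [e1 _|n1] := eqVneq k l'.1; first by apply: (key l'.1 l'.2); rewrite ?p2.
have [e2 _|n2] := eqVneq k l'.2.
  by apply: (key l'.2 l'.1); rewrite ?p1 // 1?eq_sym // crossingC.
by rewrite pair_mnm0.
Qed.

(* The quadratic terms of elements of [I_P] form a quotient of [I_P / m I_P], of dimension at most
   the number of generators, and the binomials of the crossing pairs are independent in it. *)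
Lemma size_cross_pairs_le (fs : seq S) :
  (forall p, in_IP K T le p <-> in_ideal _ fs p) -> (size L <= size fs)%N.
Proof.
move=> I_fs; pose g (a : 'I_(size L)) := tnth (in_tuple L) a.
have gL a : g a \in L by apply: mem_tnth.
have /fin_all_exists[c ec] (a : 'I_(size L)) : exists c : nat -> S,
    pair_poly K (@tail T le) (g a) = \sum_(b < size fs) c b * fs`_b.
  by apply/in_idealP/I_fs; apply: in_IP_pair_poly.
(* Constant terms of the coefficients times quadratic terms of the generators: by
   [mcoeff_mul_order2] the product collects the quadratic coefficients of the binomials, which form
   the identity matrix. *)
pose C := \matrix_(a < size L, b < size fs) (c a b)@_0%MM.
pose D := \matrix_(b < size fs, a < size L) (fs`_b)@_(pair_mnm (g a)).
apply: (@leq_of_mulmx_diag _ _ _ C D (const_mx 1)) => [|i]; last by rewrite mxE oner_eq0.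
apply/matrixP => a a'; rewrite !mxE.
transitivity ((pair_poly K (@tail T le) (g a))@_(pair_mnm (g a'))).
  rewrite ec raddf_sum; apply: eq_bigr => b _ /=; rewrite !mxE.
  rewrite mcoeff_mul_order2 //; last by rewrite mdegD !mdeg1.
  by move=> m'; apply: in_IP_order2; apply/I_fs/in_ideal_nth.
rewrite mcoeffB !mcoeffX (negPf (tail_neq_pair (gL a) (gL a'))) subr0.
rewrite (inj_in_eq pair_mnm_inj) // /g.
suff -> : (tnth (in_tuple L) a == tnth (in_tuple L) a') = (a == a').
  by case: eqP.
apply/eqP/eqP => [|->] //; rewrite !(tnth_nth (g a)) /= => /eqP.
rewrite nth_uniq //; first by move/eqP/val_inj.
by rewrite filter_uniq // enum_uniq.
Qed.

(** * Principal ideals and fraction fields *)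

Definition pmon (v : 'X_{1..#|T|}) : 'X_{1..N} :=
  (\sum_x umon le (down le (enum_val x)) *+ v x)%MM.

(* [psi] embeds the polynomial ring on the principal ideals in [S]. *)
Definition psi (q : KT) : S := q \mPo [tuple 'X_[umon le (down le (enum_val x))] | x < #|T|].

(** The endomorphism sending [t_x] to the product of the [t_y] with [y] below [x]. It is injective
    ([sigma_eq0]), and bijective on fraction fields by [quot_var]. *)
Definition sigma (q : KT) : KT := phi (psi q).

Lemma psiM p q : psi (p * q) = psi p * psi q. Proof. exact: rmorphM. Qed.
Lemma psiD p q : psi (p + q) = psi p + psi q. Proof. exact: rmorphD. Qed.
Lemma psi1 : psi 1 = 1. Proof. exact: rmorph1. Qed.
Lemma sigmaM p q : sigma (p * q) = sigma p * sigma q.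
Proof. by rewrite /sigma psiM phiPM. Qed.
Lemma sigma1 : sigma 1 = 1.
Proof. by rewrite /sigma psi1; apply: rmorph1. Qed.

Lemma sigma_mlin q : sigma q = mlin (deg \o pmon) q.
Proof. by rewrite /sigma phiP_mlin /psi comp_mpoly_mlin mlin_comp. Qed.

Lemma deg_pmon v x :
  deg (pmon v) (enum_rank x) = (\sum_(y | le x y) v (enum_rank y))%N.
Proof.
rewrite deg_sum mnm_sumE [RHS]big_mkcond /=.
rewrite (reindex (@enum_rank T)) /=; last exact: onW_bij (enum_rank_bij T).
have degMn (m : 'X_{1..N}) k : deg (m *+ k)%MM = (deg m *+ k)%MM.
  by elim: k => [|k IH]; rewrite ?mulm0n ?deg0 // !mulmS degD IH.
apply: eq_bigr => y _; rewrite degMn mulmnE enum_rankK deg_umon //; last exact: indec_down.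
by rewrite chiE inE; case: (le x y); rewrite ?mul1n.
Qed.

(** The degree at [x] sums the exponents over the elements above [x]: a unitriangular system, solved
    from the top down. *)
Lemma pmon_inj : injective (deg \o pmon).
Proof.
move=> v w /= e; apply: mnm_rankP => x.
have [n] := ubnP #|[set y | le x y]|; elim: n x => // n IH x; rewrite ltnS => Hn.
have := congr1 (fun m : 'X_{1..#|T|} => m (enum_rank x)) e.
rewrite !deg_pmon (bigD1 x) //= [RHS](bigD1 x) //=.
suff -> : (\sum_(i | le x i && (i != x)) v (enum_rank i) =
  \sum_(i | le x i && (i != x)) w (enum_rank i))%N by move/addIn.
apply: eq_bigr => y /andP[xy nyx]; apply: IH; apply: leq_trans Hn.
apply/proper_card/properP; split.
  by apply/subsetP => z; rewrite !inE => yz; case: posT => _ _ t; apply: t yz.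
exists x; rewrite !inE //; apply: contra nyx => yx.
by case: posT => _ a _; apply/eqP/a; rewrite yx.
Qed.

Lemma sigma_eq0 q : sigma q = 0 -> q = 0.
Proof. by rewrite sigma_mlin; apply: mlin_inj => v w _ _; apply: pmon_inj. Qed.

Lemma sigma_neq0 q : q != 0 -> sigma q != 0.
Proof. by apply: contra => /eqP/sigma_eq0 ->. Qed.

(** Membership in the fraction field of the image of [sigma], with denominators cleared. *)
Definition quot (p : KT) := exists W V, W != 0 /\ p * sigma W = sigma V.

Lemma quotM p q : quot p -> quot q -> quot (p * q).
Proof.
move=> [W [V [W0 e]]] [W' [V' [W0' e']]]; exists (W * W'), (V * V'); split.
  by rewrite mulf_neq0.
by rewrite !sigmaM -e -e' mulrACA.
Qed.

Lemma quot_prod (I : finType) (P : pred I) (F : I -> KT) :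
  (forall i, P i -> quot (F i)) -> quot (\prod_(i | P i) F i).
Proof.
move=> H; elim/big_rec: _ => [|i p /H]; last exact: quotM.
by exists 1, 1; split; rewrite ?oner_neq0 // mul1r.
Qed.

Lemma quot_cancel p q : q != 0 -> quot q -> quot (p * q) -> quot p.
Proof.
move=> q0 [W [V [W0 e]]] [W' [V' [W0' e']]]; exists (V * W'), (V' * W); split.
  rewrite mulf_neq0 //; apply: contraNneq q0 => V0; move/eqP: e.
  by rewrite V0 [sigma 0]sigma_mlin linear0 mulf_eq0 (negPf (sigma_neq0 W0)) orbF.
by rewrite !sigmaM -e -e'; ring.
Qed.

(** The image of [t_x] is [t_x] times the variables strictly below [x], which are quotients by
    induction. *)
Lemma quot_var x : quot 'X_(enum_rank x).
Proof.
have [n] := ubnP #|down le x|; elim: n x => // n IH x; rewrite ltnS => Hn.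
pose q : KT := \prod_(y in down le x :\ x) 'X_(enum_rank y).
apply: (@quot_cancel _ q).
- by apply/prodf_neq0 => y _; rewrite -msize_poly_eq0 msizeX.
- apply: quot_prod => y; rewrite !inE => /andP[nyx yx]; apply: IH; apply: leq_trans Hn.
  apply/proper_card/properP; split.
    by apply: down_sub; [exact: down_ideal | rewrite inE].
  exists x; first exact: mem_down.
  rewrite inE; apply: contra nyx => xy.
  by case: posT => _ a _; apply/eqP/a; rewrite yx.
exists 1, 'X_(enum_rank x); rewrite oner_neq0 sigma1 mulr1; split=> //.
rewrite sigma_mlin mlinX /= /q mprodXE -mpolyXD; congr 'X_[_].
have -> : pmon U_(enum_rank x) = umon le (down le x).
  rewrite /pmon (bigD1 (enum_rank x)) //= mnm1E eqxx mulm1n enum_rankK big1 ?addm0 //.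
  by move=> y nyx; rewrite mnm1E eq_sym (negPf nyx) mulm0n.
rewrite deg_umon //; last exact: indec_down.
by rewrite /chi [RHS](big_setD1 x) //= mem_down.
Qed.

Lemma quot_chi J : quot 'X_[chi J].
Proof. by rewrite -mprodXE; apply: quot_prod => x _; apply: quot_var. Qed.

Definition nonprincipals : seq 'I_N :=
  [seq i <- enum 'I_N | ~~ [exists x, idl i == down le x]].

(** * Elimination of the nonprincipal variables *)

Section Elimination.
Variable gs : seq S.
Hypothesis gsP : forall i, i \in nonprincipals ->
  exists W V, W != 0 /\ in_ideal _ gs ('X_i * psi W - psi V).

(** Modulo [gs], and after inverting a nonzero [psi w], [p] becomes a polynomial in the principal
    variables. *)
Definition elim (p : S) := exists w q, w != 0 /\ in_ideal _ gs (p * psi w - psi q).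

Lemma elimD p p' : elim p -> elim p' -> elim (p + p').
Proof.
move=> [w [q [w0 e]]] [w' [q' [w0' e']]]; exists (w * w'), (q * w' + q' * w); split.
  by rewrite mulf_neq0.
have -> : (p + p') * psi (w * w') - psi (q * w' + q' * w) =
    psi w' * (p * psi w - psi q) + psi w * (p' * psi w' - psi q').
  by rewrite psiD !psiM; ring.
by apply: in_idealD; apply: in_idealMl.
Qed.

Lemma elimM p p' : elim p -> elim p' -> elim (p * p').
Proof.
move=> [w [q [w0 e]]] [w' [q' [w0' e']]]; exists (w * w'), (q * q'); split.
  by rewrite mulf_neq0.
have -> : (p * p') * psi (w * w') - psi (q * q') =
    (p * psi w) * (p' * psi w' - psi q') + psi q' * (p * psi w - psi q).
  by rewrite !psiM; ring.
by apply: in_idealD; apply: in_idealMl.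
Qed.

Lemma elim_psi q : elim (psi q).
Proof.
exists 1, q; rewrite oner_neq0 psi1 mulr1 subrr; split=> //; exact: in_ideal0.
Qed.

Lemma elimX i : elim 'X_i.
Proof.
have [/existsP[x /eqP ex]|np] := boolP [exists x, idl i == down le x].
  have -> : 'X_i = psi 'X_(enum_rank x); last exact: elim_psi.
  rewrite /psi comp_mpolyXU -tnth_nth tnth_mktuple enum_rankK -ex umon_idl.
  by [].
by apply: gsP; rewrite mem_filter np mem_enum.
Qed.

Lemma elim_all p : elim p.
Proof.
elim/mpolyind: p => [|c m p _ _ ep].
  have -> : 0 = psi 0 by rewrite /psi rmorph0.
  exact: elim_psi.
apply: elimD => //; rewrite -mul_mpolyC; apply: elimM.
  have -> : c%:MP = psi c%:MP by rewrite /psi comp_mpolyC.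
  exact: elim_psi.
rewrite mpolyXE_id; elim/big_rec: _ => [|i x _ ex].
  by rewrite -psi1; apply: elim_psi.
apply: elimM => //; elim: (m i) => [|k IH]; first by rewrite expr0 -psi1; apply: elim_psi.
by rewrite exprS; apply: elimM => //; apply: elimX.
Qed.

End Elimination.

(* After inverting [psi w], the ideal [I_P] needs only one generator per nonprincipal ideal. *)
Lemma size_regular_le (fs : seq S) : regular_seq _ fs ->
  (forall p, in_IP K T le p <-> in_ideal _ fs p) -> (size fs <= size nonprincipals)%N.
Proof.
move=> reg I_fs; pose s := size nonprincipals.
pose nu (j : 'I_s) := tnth (in_tuple nonprincipals) j.
have /fin_all_exists[W] (j : 'I_s) : exists W, exists V, W != 0 /\
    'X_[chi (idl (nu j))] * sigma W = sigma V by apply: quot_chi.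
case/fin_all_exists=> V WV.
(* The relation expressing the variable of a nonprincipal ideal as a fraction in the principal
   ones. *)
pose g j : S := 'X_(nu j) * psi (W j) - psi (V j).
pose gs := [seq g j | j <- enum 'I_s].
have szg : size gs = s by rewrite size_map size_enum_ord.
have gsE (j : 'I_s) : gs`_j = g j.
  by rewrite (nth_map j) ?size_enum_ord // nth_ord_enum.
have gI j : in_IP K T le (g j).
  rewrite /in_IP phiPB phiPM phiPX degU //.
  by have [_ e] := WV j; rewrite /sigma in e; rewrite e subrr.
have gsI p : in_ideal _ gs p -> in_IP K T le p.
  by apply: in_IP_ideal => _ /mapP[j _ ->].
have gsP i : i \in nonprincipals ->
    exists W V, W != 0 /\ in_ideal _ gs ('X_i * psi W - psi V).
  case/(tnthP (in_tuple nonprincipals)) => j ->; exists (W j), (V j).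
  split; first by case: (WV j).
  by apply: in_ideal_mem; apply/mapP; exists j; rewrite ?mem_enum.
(* Elimination leaves a remainder [psi q] in the toric ideal, that is [sigma q = 0]; injectivity
   gives [q = 0]. *)
have I_gs p : in_IP K T le p -> exists w, w != 0 /\ in_ideal _ gs (p * psi w).
  move=> pI; have [w [q [w0 e]]] := elim_all gsP p; exists w; split=> //.
  suff q0 : q = 0 by rewrite q0 /psi rmorph0 subr0 in e.
  apply: sigma_eq0; have := gsI _ e; rewrite /in_IP phiPB phiPM pI mul0r sub0r.
  by move/eqP; rewrite oppr_eq0 => /eqP.
have /fin_all_exists[w] (a : 'I_(size fs)) : exists w, exists c : nat -> S, w != 0 /\
    fs`_a * psi w = \sum_(j < s) c j * gs`_j.
  have [|w [w0 /in_idealP[c]]] := I_gs fs`_a; first exact/I_fs/in_ideal_nth.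
  by rewrite szg; exists w, c.
case/fin_all_exists=> c wc.
have /fin_all_exists[d ed] (j : 'I_s) : exists d : nat -> S,
    gs`_j = \sum_(b < size fs) d b * fs`_b.
  by apply/in_idealP/I_fs; rewrite gsE.
(* Transition matrices between the two families of generators, taken modulo the toric ideal. *)
pose C := \matrix_(a < size fs, j < s) phi (c a j).
pose D := \matrix_(j < s, b < size fs) phi (d j b).
apply: (@leq_of_mulmx_diag _ _ _ C D (\row_a sigma (w a))); last first.
  by move=> a; rewrite mxE; apply: sigma_neq0; case: (wc a).
apply/matrixP => a b; rewrite !mxE.
(* Substituting one expansion into the other gives a syzygy of [fs] with these coefficients.
   Regularity puts them in the toric ideal, so [C *m D] is diagonal with entries [sigma (w a)]. *)
pose e (b : nat) : S := \sum_(j < s) c a j * d j b - (b == a :> nat)%:R * psi (w a).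
have : in_IP K T le (e b).
  apply/I_fs; apply: regular_syzygy => //.
  rewrite /e; under eq_bigr do rewrite mulrBl.
  have single : \sum_(i < size fs) (i == a)%:R * psi (w a) * fs`_i = psi (w a) * fs`_a.
    rewrite (bigD1 a) //= eqxx mul1r big1 ?addr0 // => b' nb.
    by rewrite (negPf nb) !mul0r.
  have [_ ew] := wc a; rewrite sumrB single mulrC ew; apply/eqP; rewrite subr_eq0; apply/eqP.
  under eq_bigr do rewrite mulr_suml.
  rewrite exchange_big; apply: eq_bigr => j _ /=; rewrite ed big_distrr.
  by apply: eq_bigr => b' _; rewrite /= mulrA.
rewrite /in_IP phiPB => /eqP; rewrite subr_eq0 => /eqP h.
transitivity (phi (\sum_(j < s) c a j * d j b)).
  by rewrite /phiP rmorph_sum; apply: eq_bigr => j _; rewrite !mxE /= rmorphM.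
rewrite h phiPM /sigma -val_eqE eq_sym; case: eqP => _.
  by rewrite /phiP rmorph1 mul1r.
by rewrite /phiP rmorph0 mul0r.
Qed.

(** Every nonprincipal ideal is the union of a crossing pair, and there are at most as many pairs as
    such ideals; so [U] is injective on pairs, and [matched_of_union_inj] applies. *)
Lemma complete_intersection_matched :
  complete_intersection S (in_IP K T le) -> matched le.
Proof.
move=> [fs [reg I_fs]].
pose U (l : 'I_N * 'I_N) := idl l.1 :|: idl l.2.
have sz : (size [seq U l | l <- L] <= size [seq idl i | i <- nonprincipals])%N.
  rewrite !size_map; apply: leq_trans (size_regular_le reg I_fs).
  exact: size_cross_pairs_le.
have mkp i j : crossing (idl i) (idl j) -> exists2 l, l \in L &
    (l = (i, j) \/ l = (j, i)) /\ U l = idl i :|: idl j.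
  move=> xij; case: (ltngtP i j) => [ij|ji|/val_inj eij].
  - by exists (i, j); rewrite ?mem_cross_pairs ?ij //; split=> //; left.
  - exists (j, i); rewrite ?mem_cross_pairs ?ji 1?crossingC //.
    by split; [right | rewrite /U setUC].
  - by have := crossingNl xij; rewrite eij subxx.
have sub : {subset [seq idl i | i <- nonprincipals] <= [seq U l | l <- L]}.
  move=> J /mapP[i + ->]; rewrite mem_filter negb_exists => /andP[/forallP np _].
  have [C [z [cC xC ->]]] := nonprincipal_union posT (idl_indec posT i) np.
  have [a ea] := idl_ex posT cC; have [b eb] := idl_ex posT (indec_down posT z).
  rewrite -ea -eb in xC *; have [l lL [_ <-]] := mkp a b xC.
  exact: map_f.
have uN : uniq [seq idl i | i <- nonprincipals].
  by rewrite (map_inj_uniq (@idl_inj T le)) filter_uniq // enum_uniq.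
(* A duplicate-free list contained in one that is no longer forces the latter to be
   duplicate-free. *)
have uL := leq_size_uniq uN sub sz.
have injU l l' : l \in L -> l' \in L -> U l = U l' -> l = l'.
  move=> lL l'L e; rewrite -(nth_index l lL) -(nth_index l l'L).
  congr (nth l L _); apply/eqP; rewrite -(nth_uniq (U l) _ _ uL) ?size_map ?index_mem //.
  by rewrite !(nth_map l) ?index_mem // !nth_index // e.
apply: matched_of_union_inj => A B C D cA cB cC cD xAB xCD e.
have [a ea] := idl_ex posT cA; have [b eb] := idl_ex posT cB.
have [c ec] := idl_ex posT cC; have [d ed] := idl_ex posT cD.
rewrite -ea -eb -ec -ed in xAB xCD e *.
have [l lL [lab Ul]] := mkp _ _ xAB; have [l' l'L [lcd Ul']] := mkp _ _ xCD.
have el : l = l' by apply: injU => //; rewrite Ul Ul'.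
rewrite -el in lcd.
by case: lab lcd => ->; case=> -[-> ->]; [left | right | right | left].
Qed.

End Converse.

Unset Implicit Arguments.

Theorem theorem2p4 (T : finType) (le : rel T) (K : fieldType) :
  is_poset T le -> (0 < #|T|)%N ->
  (forest_dup (FinPoset T le) <->
   complete_intersection (Sring K T le) (in_IP K T le)).
Proof.
move=> posT T0; split=> [/forest_dup_matched [_ mT]|ci].
  exact: matched_complete_intersection.
by apply: matched_forest_dup => //; apply: complete_intersection_matched ci.
Qed.
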